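(* Let $f_j(x)=\lambda R_\alpha x+t_j$, $j=1,\dots,k$, be maps on $\mathbb{R}^2$, where $\lambda\in(0,1)$, $R_\alpha$ is rotation by $\alpha\in[0,2\pi)$ and $t_j\in\mathbb{R}^2$. Let $\overline{\eta}$ be a Borel probability measure on $\mathbb{X}_\infty=\{1,\dots,k\}^{\mathbb{N}}$ such that, for some $K>1$, $$\overline{\eta}([uv])\le K\,\overline{\eta}([u])\,\overline{\eta}([v])$$ for all finite words $u\in\{1,\dots,k\}^m$, $v\in\{1,\dots,k\}^n$, and let $\eta$ be the projection (push-forward) of $\overline{\eta}$ under the coding map. If $\alpha/\pi$ is irrational, then for all $q\in(1,2]$ and all $v\in S^1$ it holds that $$D_q(\Pi_v\eta)=\min(D_q(\eta),1),$$ and moreover the convergence of $-\frac{\log\mathcal{C}^q_{\Pi_v\eta}(n)}{n(q-1)}$ to $\min(D_q(\eta),1)$ as $n\to\infty$ is uniform over $v\in S^1$.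
   Context: For a finite word $u$, $[u]$ is the set of infinite words starting with $u$; $uv$ denotes concatenation. The coding map sends $u=(u_1,u_2,\dots)$ to the unique point of $\bigcap_{n\ge1}f_{u_1}\circ\cdots\circ f_{u_n}(B)$, where $B$ is a closed ball centered at $0$, large enough that $f_j(B)\subset B$ for all $j$. For $v\in S^1\subset\mathbb{R}^2$, $\Pi_v(x)=\langle x,v\rangle$, and $\Pi_v\eta$ is the push-forward. Logarithms are to base $2$. For a Borel probability measure $\rho$ on $\mathbb{R}^d$, $\mathcal{C}^q_\rho(n)=\sum_{I\in\mathfrak{D}_n}\rho(I)^q$, where $\mathfrak{D}_n=\{2^{-n}([0,1)^d+j): j\in\mathbb{Z}^d\}$, and for $q>1$ the $L^q$ dimension is $D_q(\rho)=\lim_{n\to\infty}\frac{\log\mathcal{C}^q_\rho(n)}{-n(q-1)}$ when the limit exists. The existence of all $L^q$ dimensions mentioned is part of the conclusion. *)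

(* Defs.v *)
From HB Require Import structures.
From mathcomp Require Export all_boot all_order all_algebra.
From mathcomp Require Export all_classical all_reals all_analysis.

Set Implicit Arguments.
Unset Strict Implicit.
Unset Printing Implicit Defensive.

Export Order.TTheory GRing.Theory Num.Theory.
Export numFieldNormedType.Exports.

#[export] Set Implicit Arguments.
#[export] Unset Strict Implicit.
#[export] Unset Printing Implicit Defensive.

Local Open Scope classical_set_scope.
Local Open Scope ring_scope.

(** * Infinite words over a nonempty finite alphabet *)

(* 'I_k.+1 stands for {1, ..., k + 1}: there is no probability measure on the
   set of infinite words over the empty alphabet. *)
HB.instance Definition _ (k : nat) := isPointed.Build 'I_k.+1 ord0.

(* Infinite words, with the Borel sets of the product of the discrete
   topologies. *)
Definition word_space (k : nat) :=
  g_sigma_algebraType (@open {ptws nat -> discrete_topology 'I_k.+1}).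

HB.instance Definition _ (k : nat) := Measurable.on (word_space k).

Definition cylinder (k : nat) (u : seq 'I_k.+1) : set (word_space k) :=
  [set w | mkseq w (size u) = u].

(** * The Euclidean plane *)

Section Plane.
Variable R : realType.

(* The norm of R * R in the library is the sup norm. *)
Definition dotp (x y : R * R) : R := x.1 * y.1 + x.2 * y.2.

Definition enorm (x : R * R) : R := Num.sqrt (dotp x x).

Definition eclosed_ball (r : R) : set (R * R) := [set x | enorm x <= r].

Definition circle : set (R * R) := [set v | enorm v = 1].

Definition rotation (a : R) (x : R * R) : R * R :=
  (cos a * x.1 - sin a * x.2, sin a * x.1 + cos a * x.2).

Definition similarity (lambda a : R) (t x : R * R) : R * R :=
  (lambda * (rotation a x).1 + t.1, lambda * (rotation a x).2 + t.2).

Definition proj_dir (v : R * R) (x : R * R) : R := dotp x v.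

Definition word_map (k : nat) (f : 'I_k.+1 -> R * R -> R * R)
    (u : seq 'I_k.+1) (x : R * R) : R * R :=
  foldr f x u.

(* When the f j are contractions mapping B to itself, the intersection is a
   singleton and the default value of xget plays no role. *)
Definition coding (k : nat) (f : 'I_k.+1 -> R * R -> R * R) (B : set (R * R))
    (u : word_space k) : R * R :=
  xget (0, 0)
    (\bigcap_(n in [set n | (1 <= n)%N]) (word_map f (mkseq u n) @` B)).

End Plane.

(** * L^q dimensions *)

Section LqDimension.
Variable R : realType.

Definition log2 (x : R) : R := ln x / ln 2.

Definition dyadic1 (n : nat) (j : int) : set R :=
  `[2 ^- n * j%:~R, 2 ^- n * (j%:~R + 1)[%classic.

Definition dyadic2 (n : nat) (j : int * int) : set (R * R) :=
  dyadic1 n j.1 `*` dyadic1 n j.2.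

(* D n enumerates the dyadic cells of side 2^-n; it is instantiated with
   dyadic1 on R and with dyadic2 on R^2. *)
Definition Lq_sum (J : choiceType) (T : Type) (D : nat -> J -> set T)
    (rho : set T -> \bar R) (q : R) (n : nat) : \bar R :=
  (\esum_(j in [set: J]) (rho (D n j) `^ q))%E.

(* For a probability measure rho and q > 1 the sum lies in ]0, 1], so that
   fine loses nothing. *)
Definition Lq_ratio (J : choiceType) (T : Type) (D : nat -> J -> set T)
    (rho : set T -> \bar R) (q : R) (n : nat) : R :=
  log2 (fine (Lq_sum D rho q n)) / - (n%:R * (q - 1)).

(* Meaningful only when Lq_ratio D rho q converges. *)
Definition Lq_dim (J : choiceType) (T : Type) (D : nat -> J -> set T)
    (rho : set T -> \bar R) (q : R) : R :=
  limn (Lq_ratio D rho q).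

End LqDimension.

(* Main.v *)
Require Import Defs.
From mathcomp Require Import ring lra zify.

(** The measure is compared, at the scale [lambda ^+ n], with the finite sums
    [grid_sum n h]: the words of length [n] are sorted according to the cell of
    side [lambda ^+ n] that contains their points, seen in the frame [h], and the
    q-th powers of the masses of the cells are added. Here [h] is the standard
    frame of the plane, or a direction [v]. All estimates hold up to constants
    that depend neither on [n] nor on [v], and such constants disappear in the
    dimension. By [ln_cell_energy] these sums can replace the dyadic ones; this
    needs that the coded point of an infinite word is close to the points of its
    prefixes, [coding_close], and that it is a measurable function of the word,
    [measurable_slab].

    The part of the measure carried by the words with prefix [u] is at most [K]
    times the mass of [u] times a copy of the whole measure, scaled by
    [lambda ^+ size u] and rotated. With convexity of the q-th power this makes
    the sums submultiplicative, [grid_sum_submul]: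
    [grid_sum (n + m) h <= C * grid_sum n h * grid_sum m h'], where [h'] is [h]
    rotated by [- n * alpha]. For the plane the rotation costs only a constant,
    so Fekete's lemma provides a limit [L] of [ln (grid_sum n) / n], see
    [grid_sum_std_limit], and the dimension of the measure is
    [L / ((q - 1) * ln lambda)].

    For the projections the sums form a submultiplicative cocycle over the
    irrational rotation by [alpha]. A lower bound of the sums, uniform in [v], is
    easy: cells of the plane project into boundedly many intervals, and there are
    [O(lambda ^- n)] intervals, [grid_sum_line_lower_log]. For the upper bound
    [grid_sum_line_upper] a long block of length [m] is fixed. Submultiplicativity
    and the inequality between the geometric and the arithmetic mean bound the
    sum at the scale [n] by the power [n / m] of [C] times the average of
    [grid_sum m] over a piece of the orbit of [v] under the rotation by
    [m * alpha]; the constant [C] is negligible for long blocks. By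
    [orbit_average] this average is controlled as soon as the piece is long,
    uniformly in [v]: this is the proof of Marstrand's projection
    theorem for [q <= 2], in which the average over all directions is replaced by
    the average over the orbit. It only uses that the projection of [x - y] to
    the directions of the orbit is less than [lambda ^+ m] with frequency
    [O(lambda ^+ m / |x - y|)], that is, that an orbit of an irrational rotation
    visits an arc at most as often as a constant times its length,
    [rotation_frequency]. The outcome is a sum over [j <= m] of
    [lambda ^+ ((m - j) * (q - 1))] times the sum for the plane at the scale
    [lambda ^+ j], whose exponential rate is the larger one of [L] and
    [(q - 1) * ln lambda]. Divided by [(q - 1) * ln lambda] this is the minimum
    of the dimension of the measure and 1. *)

Local Open Scope ring_scope.

(** * Power means and partitions *)

Section PowerSums.
Variable R : realType.
Implicit Types (x y s q : R).

(** Concavity of the logarithm between [x / y] and [1]. *)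
Lemma powR_le_tangent s x y : 0 <= s <= 1 -> 0 <= x -> 0 < y ->
  x `^ s <= y `^ s + s * y `^ (s - 1) * (x - y).
Proof.
move=> /andP[s0 s1] x0 y0.
have ys : y `^ s = y `^ (s - 1) * y.
  by rewrite -{3}(powRr1 (ltW y0)) -powRD subrK// (gt_eqF y0) implybT.
suff : (x / y) `^ s <= 1 + s * (x / y - 1).
  move=> h.
  have := ler_wpM2r (powR_ge0 y s) h.
  rewrite -powRM ?divr_ge0 ?(ltW y0)// divfK ?gt_eqF// => /le_trans; apply.
  rewrite [in leLHS]ys [in leRHS]ys le_eqVlt; apply/orP; left; apply/eqP; field.
  by rewrite gt_eqF.
have : 0 <= x / y by rewrite divr_ge0// ltW.
move: (x / y) => u; rewrite le_eqVlt => /predU1P[<-|u0].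
  have [->|sN0] := eqVneq s 0; first by rewrite powRr0 mul0r addr0.
  by rewrite powR0//; lra.
rewrite -ler_ln ?posrE ?powR_gt0//; last by nra.
rewrite ln_powR.
have := @concave_ln R (Itv01 s0 s1) u 1 u0 ltr01.
rewrite !convRE /= ln1 mulr0 addr0 /unstable.onem mulr1.
by have -> : s * u + (1 - s) = 1 + s * (u - 1) by ring.
Qed.

(** This is [powR_le_tangent] for the exponent [q^-1], at the points [x `^ q]
    and [y `^ q]. *)
Lemma powR_ge_tangent q x y : 1 <= q -> 0 <= x -> 0 < y ->
  y `^ q + q * y `^ (q - 1) * (x - y) <= x `^ q.
Proof.
move=> q1 x0 y0; have q0 : 0 < q by lra.
have qV : 0 <= q^-1 <= 1 by rewrite invr_ge0 (ltW q0)/= invf_le1.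
have := powR_le_tangent qV (powR_ge0 x q) (powR_gt0 q y0).
rewrite -!powRrM mulfV ?gt_eqF// !powRr1 ?(ltW y0)//.
have -> : y `^ (q * (q^-1 - 1)) = (y `^ (q - 1))^-1.
  by rewrite mulrBr mulfV ?gt_eqF// mulr1 -opprB powRN.
have p0 := powR_gt0 (q - 1) y0.
rewrite -[x <= _](ler_pM2l (mulr_gt0 q0 p0)).
have -> : q * y `^ (q - 1) * (y + q^-1 / y `^ (q - 1) * (x `^ q - y `^ q)) =
  q * y `^ (q - 1) * y + (x `^ q - y `^ q).
  by field; rewrite !gt_eqF.
lra.
Qed.

Section Sums.
Variables (I : eqType) (l : seq I) (P : pred I).
Implicit Types (w a : I -> R).

(** Jensen's inequality for weights that need not sum to 1: the tangent at the
    weighted mean lies below the power, and its weighted sum is explicit. *)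
Lemma powR_sum_wmean q w a : 1 <= q ->
  (forall i, 0 <= w i) -> (forall i, 0 <= a i) ->
  (\sum_(i <- l | P i) w i * a i) `^ q <=
  (\sum_(i <- l | P i) w i) `^ (q - 1) * \sum_(i <- l | P i) w i * a i `^ q.
Proof.
move=> q1 w0 a0; set W := \sum_(i <- l | P i) w i.
set A := \sum_(i <- l | P i) w i * a i.
have q0 : q != 0 by rewrite gt_eqF//; lra.
have W0 : 0 <= W by apply: sumr_ge0.
have A0 : 0 <= A by apply: sumr_ge0 => i _; rewrite mulr_ge0.
have S0 : 0 <= \sum_(i <- l | P i) w i * a i `^ q.
  by apply: sumr_ge0 => i _; rewrite mulr_ge0// powR_ge0.
move: A0; rewrite le_eqVlt => /predU1P[<-|A0].
  by rewrite powR0// mulr_ge0// powR_ge0.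
have W1 : 0 < W.
  rewrite lt_neqAle W0 andbT; apply/eqP => W00.
  suff A00 : A = 0 by rewrite A00 ltxx in A0.
  have /eqP := W00; rewrite eq_sym psumr_eq0// => /allP wz.
  by rewrite /A big1_seq// => i /andP[Pi /wz /implyP/(_ Pi)/eqP ->]; rewrite mul0r.
set y := A / W.
have y0 : 0 < y by rewrite divr_gt0.
have : W * y `^ q <= \sum_(i <- l | P i) w i * a i `^ q.
  apply: (@le_trans _ _
    (\sum_(i <- l | P i) (w i * (y `^ q) + (q * y `^ (q - 1) * (w i * a i) -
        q * y `^ (q - 1) * y * w i)))); last first.
    apply: ler_sum => i _.
    have := ler_wpM2l (w0 i) (powR_ge_tangent q1 (a0 i) y0).
    by apply: le_trans; rewrite le_eqVlt; apply/orP; left; apply/eqP; ring.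
  rewrite !big_split /= sumrN -mulr_suml -!mulr_sumr -/W -/A.
  rewrite -[X in _ - X]mulrA (_ : y * W = A); last by rewrite divfK ?gt_eqF.
  rewrite le_eqVlt; apply/orP; left; apply/eqP; ring.
move=> /(ler_wpM2l (powR_ge0 W (q - 1))); apply: le_trans.
rewrite /y powRM ?(ltW A0) ?invr_ge0// -powR_inv1// -powRrM.
rewrite (_ : W `^ (q - 1) * _ = A `^ q * (W * W `^ (q - 1) * W `^ (-1 * q))).
  by rewrite mulr_powRB1// -?powRD ?mulN1r ?subrr ?powRr0 ?mulr1//;
    [rewrite (gt_eqF W1) implybT|lra].
by ring.
Qed.

(** The concave counterpart of [powR_sum_wmean]; it later moves an average over
    directions inside a power. *)
Lemma wmean_powR_sum s w a : 0 <= s <= 1 ->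
  (forall i, 0 <= w i) -> (forall i, 0 <= a i) ->
  \sum_(i <- l | P i) w i = 1 ->
  \sum_(i <- l | P i) w i * a i `^ s <= (\sum_(i <- l | P i) w i * a i) `^ s.
Proof.
move=> s01 w0 a0 w1; set A := \sum_(i <- l | P i) w i * a i.
have A0 : 0 <= A by apply: sumr_ge0 => i _; rewrite mulr_ge0.
move: A0; rewrite le_eqVlt => /predU1P[A00|A0].
  (* The terms [w i * a i] vanish, and [w] does not vanish altogether. *)
  have [->|sN0] := eqVneq s 0.
    by under eq_bigr do rewrite powRr0 mulr1; rewrite w1 powRr0.
  have := esym A00 => /eqP; rewrite psumr_eq0; last by move=> i _; rewrite mulr_ge0.
  move=> /allP wz; rewrite big1_seq ?powR_ge0// => i /andP[Pi /wz /implyP/(_ Pi)].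
  by rewrite mulf_eq0 => /orP[/eqP->|/eqP->]; rewrite ?mul0r// powR0// mulr0.
apply: (@le_trans _ _
    (\sum_(i <- l | P i) (w i * (A `^ s) + (s * A `^ (s - 1) * (w i * a i) -
        s * A `^ (s - 1) * A * w i)))).
  apply: ler_sum => i _.
  have := ler_wpM2l (w0 i) (powR_le_tangent s01 (a0 i) A0).
  by move=> /le_trans; apply; rewrite le_eqVlt; apply/orP; left; apply/eqP; ring.
rewrite !big_split /= sumrN -mulr_suml -!mulr_sumr -/A w1.
rewrite le_eqVlt; apply/orP; left; apply/eqP; ring.
Qed.

(** No [a i] exceeds the whole sum [A], so
    [a i `^ q <= a i * A `^ (q - 1)]. *)
Lemma sum_powR_le q a : 1 <= q -> (forall i, 0 <= a i) ->
  \sum_(i <- l | P i) a i `^ q <= (\sum_(i <- l | P i) a i) `^ q.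
Proof.
move=> q1 a0; have q0 : 0 < q by lra.
rewrite -[leRHS]mulr_powRB1//; last by apply: sumr_ge0.
rewrite mulr_suml big_seq_cond [leRHS]big_seq_cond; apply: ler_sum => i /andP[il Pi].
rewrite -[leLHS]mulr_powRB1// ler_wpM2l// ge0_ler_powR ?nnegrE//; first by lra.
  by apply: sumr_ge0.
by rewrite (big_rem i)//= Pi lerDl sumr_ge0.
Qed.

(** No ratio [u] of [a i] to the whole sum exceeds 1, so [u <= u `^ s]. *)
Lemma powR_sum_le s a : 0 < s <= 1 -> (forall i, 0 <= a i) ->
  (\sum_(i <- l | P i) a i) `^ s <= \sum_(i <- l | P i) a i `^ s.
Proof.
move=> /andP[s0 s1] a0; set A := \sum_(i <- l | P i) a i.
have A0 : 0 <= A by apply: sumr_ge0.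
move: A0; rewrite le_eqVlt => /predU1P[<-|A0].
  by rewrite powR0 ?gt_eqF// sumr_ge0// => i _; exact: powR_ge0.
have -> : A `^ s = \sum_(i <- l | P i) A `^ s * (a i / A).
  by rewrite -mulr_sumr -mulr_suml -/A mulfV ?gt_eqF// mulr1.
rewrite big_seq_cond [leRHS]big_seq_cond; apply: ler_sum => i /andP[il Pi].
have aA : 0 <= a i / A <= 1.
  rewrite divr_ge0 ?(ltW A0)//= ler_pdivrMr// mul1r.
  by rewrite /A (big_rem i)//= Pi lerDl sumr_ge0.
have -> : a i `^ s = A `^ s * (a i / A) `^ s.
  by rewrite -powRM ?divr_ge0 ?(ltW A0)// mulrCA mulfV ?gt_eqF// mulr1.
rewrite ler_wpM2l ?powR_ge0//.
move: aA => /andP[]; rewrite le_eqVlt => /predU1P[<-|u0 u1]; first by rewrite powR_ge0.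
by rewrite ger1_powR// u0.
Qed.

(** Jensen's inequality for the counting weight on the nonzero terms. *)
Lemma powR_sum_count q (N : nat) a : 1 <= q -> (forall i, 0 <= a i) ->
  (count (fun i => P i && (a i != 0)%R) l <= N)%N ->
  (\sum_(i <- l | P i) a i) `^ q <= N%:R `^ (q - 1) * \sum_(i <- l | P i) a i `^ q.
Proof.
move=> q1 a0 cN; have q0 : 0 < q by lra.
have E (f : R -> R) : f 0 = 0 -> \sum_(i <- l | P i) f (a i) =
    \sum_(i <- l | P i) (a i != 0)%:R * f (a i).
  by move=> f0; apply: eq_bigr => i _; case: eqP => [->|_]; rewrite ?f0 ?mul0r ?mul1r.
rewrite (E id)// (E (fun x => x `^ q)) ?powR0 ?gt_eqF//.
apply: (le_trans (powR_sum_wmean q1 _ _)) => //=.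
rewrite ler_wpM2r//; first by apply: sumr_ge0 => i _; rewrite mulr_ge0// powR_ge0.
rewrite ge0_ler_powR ?nnegrE ?ler0n//; first by lra.
- by apply: sumr_ge0 => i _; rewrite ler0n.
rewrite -natr_sum ler_nat (leq_trans _ cN)// -sum1_count big_mkcondr/=.
by rewrite leq_sum// => i _; case: ifP.
Qed.

End Sums.

(** [m i j] is the mass of the intersection of the [i]-th cell of one partition
    with the [j]-th cell of another one. A cell that meets at most [N] cells of
    the other partition loses at most a factor [N `^ (q - 1)] when it is cut by
    them, and a sum of q-th powers only grows when its terms are merged. *)
Lemma compare_partitions (I J : eqType) (s : seq I) (s' : seq J)
    (m : I -> J -> R) q (N : nat) : 1 <= q -> (forall i j, 0 <= m i j) ->
  (forall i, i \in s -> (count (fun j => m i j != 0)%R s' <= N)%N) ->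
  \sum_(i <- s) (\sum_(j <- s') m i j) `^ q <=
  N%:R `^ (q - 1) * \sum_(j <- s') (\sum_(i <- s) m i j) `^ q.
Proof.
move=> q1 m0 cN.
apply: (@le_trans _ _ (\sum_(i <- s) N%:R `^ (q - 1) * \sum_(j <- s') m i j `^ q)).
  rewrite big_seq [leRHS]big_seq; apply: ler_sum => i si.
  by apply: powR_sum_count => //; exact: cN.
rewrite -mulr_sumr exchange_big/= ler_wpM2l ?powR_ge0//.
by apply: ler_sum => j _; apply: sum_powR_le.
Qed.

End PowerSums.

(** * Sums of q-th powers of the masses of cells *)

Section Keys.
Variable R : realType.

Section PowerSum.
Variables (T J : eqType) (l : seq T) (p : T -> R) (g : T -> J).

Definition cell_mass (j : J) : R := \sum_(u <- l | g u == j) p u.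

(** The keys are taken from [l], because the type of keys may be infinite. *)
Definition power_sum (q : R) : R :=
  \sum_(j <- undup (map g l)) cell_mass j `^ q.

Lemma sum_by_key (s : seq J) (F : T -> J -> R) :
  uniq s -> {subset map g l <= s} ->
  \sum_(j <- s) \sum_(u <- l | g u == j) F u j = \sum_(u <- l) F u (g u).
Proof.
move=> us gs; under eq_bigr do rewrite big_mkcond/=.
rewrite exchange_big/= [RHS]big_seq [LHS]big_seq; apply: eq_bigr => u ul.
rewrite (bigD1_seq (g u)) ?gs ?map_f//= eqxx.
by rewrite big1_seq ?addr0// => j /andP[]; rewrite eq_sym => /negPf->.
Qed.

Lemma cell_mass_ge0 j : (forall u, 0 <= p u) -> 0 <= cell_mass j.
Proof. by move=> p0; apply: sumr_ge0. Qed.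

Lemma power_sum_ge0 q : 0 <= power_sum q.
Proof. by apply: sumr_ge0 => j _; apply: powR_ge0. Qed.

Lemma sum_cell_mass : \sum_(j <- undup (map g l)) cell_mass j = \sum_(u <- l) p u.
Proof.
rewrite (sum_by_key (fun u _ => p u)) ?undup_uniq// => j.
by rewrite mem_undup.
Qed.

(** The energy form of the sum: it is linear in the outer mass, which the
    averaging over directions uses. *)
Lemma power_sum_energy q : 0 < q -> (forall u, 0 <= p u) ->
  power_sum q = \sum_(u <- l) p u * cell_mass (g u) `^ (q - 1).
Proof.
move=> q0 p0.
rewrite -(sum_by_key (fun u j => p u * cell_mass j `^ (q - 1)) (undup_uniq (map g l))).
  by apply: eq_bigr => j _; rewrite -mulr_suml mulr_powRB1// cell_mass_ge0.
by move=> j; rewrite mem_undup.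
Qed.

End PowerSum.

Lemma power_sum_le1 (T J : eqType) (l : seq T) (p : T -> R) (g : T -> J) q :
  1 <= q -> (forall u, 0 <= p u) -> \sum_(u <- l) p u = 1 ->
  power_sum l p g q <= 1.
Proof.
move=> q1 p0 p1; apply: (le_trans (sum_powR_le _ _ q1 _)).
  by move=> j; apply: cell_mass_ge0.
by rewrite sum_cell_mass p1 powR1.
Qed.

(** Only the cells of [g] have to meet few cells of [g']: in the other direction
    cells are merged, and this increases the sum. *)
Lemma power_sum_cmp (T J J' : eqType) (l : seq T) (p : T -> R) (g : T -> J)
    (g' : T -> J') q (N : nat) :
  1 <= q -> (forall u, 0 <= p u) ->
  (forall i, (count (fun j => has (fun u => (g u == i) && (g' u == j)) l)
     (undup (map g' l)) <= N)%N) ->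
  power_sum l p g q <= N%:R `^ (q - 1) * power_sum l p g' q.
Proof.
move=> q1 p0 cN.
pose m i j := \sum_(u <- l | (g u == i) && (g' u == j)) p u.
have m0 i j : 0 <= m i j by apply: sumr_ge0.
have := @compare_partitions _ _ _ (undup (map g l)) (undup (map g' l)) m q N q1 m0.
have -> : power_sum l p g q =
    \sum_(i <- undup (map g l)) (\sum_(j <- undup (map g' l)) m i j) `^ q.
  apply: eq_bigr => i _; congr (_ `^ _); rewrite /m.
  under [RHS]eq_bigr do under eq_bigl do rewrite andbC.
  under [RHS]eq_bigr do rewrite big_mkcondr.
  rewrite (@sum_by_key _ _ l g' _ (fun u j => if g u == i then p u else 0)) ?undup_uniq//.
    by rewrite -big_mkcond.
  by move=> j; rewrite mem_undup.
have -> : power_sum l p g' q =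
    \sum_(j <- undup (map g' l)) (\sum_(i <- undup (map g l)) m i j) `^ q.
  apply: eq_bigr => j _; congr (_ `^ _); rewrite /m.
  under [RHS]eq_bigr do rewrite big_mkcondr.
  rewrite (@sum_by_key _ _ l g _ (fun u i => if g' u == j then p u else 0)) ?undup_uniq//.
    by rewrite -big_mkcond.
  by move=> i; rewrite mem_undup.
apply => i _; apply: leq_trans (cN i); apply: sub_count => j /=.
apply: contraNT => /hasPn h; apply/eqP; rewrite /m big1_seq// => u /andP[gu ul].
by have := h u ul; rewrite gu.
Qed.

(** * Cells of a grid in the plane *)

Definition grid_key (d : R) (x : R * R) : int * int :=
  (Num.floor (x.1 / d), Num.floor (x.2 / d)).

Lemma floor_close (x y : R) (A : nat) : `|x - y| <= A%:R ->
  `|Num.floor x - Num.floor y| <= A%:Z.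
Proof.
have [/(_ x) fx /(_ y) fy] := (@floor_itv R, @floor_itv R).
rewrite ler_norml => /andP[h1 h2].
move/andP: fx => [a b]; move/andP: fy => [c d].
move: (Num.floor x) (Num.floor y) a b c d => X Y a b c d.
suff [e1 e2] : X < Y + A%:Z + 1 /\ Y < X + A%:Z + 1 by lia.
by split; rewrite -(ltr_int R) !intrD /=; move: b d; rewrite !intrD/=; lra.
Qed.

Lemma floor_eq_close (x y : R) : Num.floor x = Num.floor y -> `|x - y| <= 1.
Proof.
move=> e; have /andP[a b] := floor_itv x; have /andP[c d] := floor_itv y.
by rewrite e in a b; rewrite ler_norml; move: b d; rewrite !intrD/=; lra.
Qed.

Lemma grid_key_eq (d : R) (x y : R * R) : 0 < d -> grid_key d x = grid_key d y ->
  `|x.1 - y.1| <= d /\ `|x.2 - y.2| <= d.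
Proof.
move=> d0 [/floor_eq_close h1 /floor_eq_close h2].
by split; rewrite -[d]mul1r -ler_pdivrMr// -[X in _ / X](gtr0_norm d0)
  -normf_div mulrBl.
Qed.

Lemma grid_key_close (d : R) (x y : R * R) (A B : nat) : 0 < d ->
  `|x.1 - y.1| <= A%:R * d -> `|x.2 - y.2| <= B%:R * d ->
  `|(grid_key d x).1 - (grid_key d y).1| <= A%:Z /\
  `|(grid_key d x).2 - (grid_key d y).2| <= B%:Z.
Proof.
by move=> d0 h1 h2; split; apply: floor_close;
  rewrite -mulrBl normf_div (gtr0_norm d0) ler_pdivrMr.
Qed.

(** All these keys lie in the box around any one of them. *)
Lemma count_close (s : seq (int * int)) (P : pred (int * int)) (A B : nat) :
  uniq s -> (forall i j, P i -> P j -> `|i.1 - j.1| <= A%:Z /\ `|i.2 - j.2| <= B%:Z) ->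
  (count P s <= A.*2.+1 * B.*2.+1)%N.
Proof.
move=> us cl; rewrite -size_filter.
have := filter_uniq P us; have : all P (seq.filter P s) by exact: filter_all.
case: (seq.filter P s) => [//|i0 t] al ut.
pose f (i : int * int) : 'I_(A.*2.+1) * 'I_(B.*2.+1) :=
  (inord (absz (i.1 - i0.1 + A%:Z)), inord (absz (i.2 - i0.2 + B%:Z))).
have Pi0 : P i0 by case/andP: al.
have fi : {in i0 :: t &, injective f}.
  move=> i j /(allP al) Pi /(allP al) Pj [].
  have [h1 h2] := cl _ _ Pi Pi0; have [h3 h4] := cl _ _ Pj Pi0.
  move=> /(congr1 val) /= e1 /(congr1 val) /= e2.
  rewrite !inordK in e1; try lia.
  rewrite !inordK in e2; try lia.
  by move: e1 e2 h1 h2 h3 h4; case: i {Pi} => a b; case: j {Pj} => c d /= *; congr (_, _); lia.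
have : uniq (map f (i0 :: t)) by rewrite map_inj_in_uniq.
by move/card_uniqP; rewrite size_map => <-; rewrite (leq_trans (max_card _))// card_prod !card_ord.
Qed.

(** This inequality serves to change the scale, the frame, the origin of the
    grid, and to replace a word by a prefix. *)
Lemma power_sum_grid_cmp (T : eqType) (l : seq T) (p : T -> R) q
    (F G : T -> R * R) (d d' : R) (A B : nat) :
  1 <= q -> (forall u, 0 <= p u) -> 0 < d -> 0 < d' ->
  (forall u u', u \in l -> u' \in l -> `|(F u).1 - (F u').1| <= d -> `|(F u).2 - (F u').2| <= d ->
    `|(G u).1 - (G u').1| <= A%:R * d' /\ `|(G u).2 - (G u').2| <= B%:R * d') ->
  power_sum l p (fun u => grid_key d (F u)) q <=
  (A.*2.+1 * B.*2.+1)%:R `^ (q - 1) * power_sum l p (fun u => grid_key d' (G u)) q.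
Proof.
move=> q1 p0 d0 d0' FG; apply: power_sum_cmp => // i.
apply: count_close; first exact: undup_uniq.
move=> j j' /hasP[u ul /andP[/eqP gu /eqP <-]] /hasP[u' ul' /andP[/eqP gu' /eqP <-]].
have [h1 h2] := grid_key_eq d0 (etrans gu (esym gu')).
by have [] := FG _ _ ul ul' h1 h2; apply: grid_key_close.
Qed.

End Keys.

(** * Product measures and words *)

Section Product.
Variable R : realType.

Lemma power_sum_keys (T J : eqType) (l : seq T) (p : T -> R) (g : T -> J) q (s : seq J) :
  0 < q -> uniq s -> {subset map g l <= s} ->
  power_sum l p g q = \sum_(j <- s) cell_mass l p g j `^ q.
Proof.
move=> q0 us gs; rewrite [RHS](bigID (mem (map g l)))/= [X in _ + X]big1 ?addr0.
  rewrite -[RHS]big_filter /power_sum; apply: perm_big; apply: uniq_perm.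
  - exact: undup_uniq.
  - exact: filter_uniq.
  - move=> j; rewrite mem_undup mem_filter; case: (boolP (j \in map g l)) => //= h.
    by rewrite gs.
move=> j /negP hj; rewrite /cell_mass big1_seq ?powR0 ?gt_eqF// => u /andP[/eqP gu ul].
by case: hj; rewrite -gu map_f.
Qed.

Lemma power_sum_map (S T J : eqType) (l : seq S) (h : S -> T) (p : T -> R) (g : T -> J) q :
  power_sum (map h l) p g q = power_sum l (p \o h) (g \o h) q.
Proof.
rewrite /power_sum -map_comp; apply: eq_bigr => j _.
by rewrite /cell_mass big_map.
Qed.

(** Cutting a cell of the product by the cells of the first factor and using
    convexity decouples the two factors. *)
Lemma power_sum_product (S T I J : eqType) (l : seq S) (l' : seq T)
    (p : S -> R) (p' : T -> R) (pp : S * T -> R) (g : S -> I) (g' : S -> T -> J)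
    (q K C : R) : 1 <= q -> 0 <= K ->
  (forall u, 0 <= p u) -> (forall w, 0 <= p' w) -> (forall uw, 0 <= pp uw) ->
  (forall u w, pp (u, w) <= K * p u * p' w) ->
  (forall u, u \in l -> power_sum l' p' (g' u) q <= C) ->
  power_sum [seq (u, w) | u <- l, w <- l'] pp
    (fun uw => (g uw.1, g' uw.1 uw.2)) q <= K `^ q * (power_sum l p g q * C).
Proof.
move=> q1 K0 p0 p0' pp0 ppK gC; have q0 : 0 < q by lra.
pose sJ := undup [seq g' u w | u <- l, w <- l'].
rewrite (@power_sum_keys _ _ _ _ _ _ [seq (i, j) | i <- undup (map g l), j <- sJ])//.
- rewrite big_allpairs/=.
  have step i : \sum_(j <- sJ) cell_mass [seq (u, w) | u <- l, w <- l'] pp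
        (fun uw => (g uw.1, g' uw.1 uw.2)) (i, j) `^ q <=
      K `^ q * (cell_mass l p g i `^ q * C).
    have cell j : cell_mass [seq (u, w) | u <- l, w <- l'] pp
        (fun uw => (g uw.1, g' uw.1 uw.2)) (i, j) <=
        K * \sum_(u <- l | g u == i) p u * cell_mass l' p' (g' u) j.
      rewrite /cell_mass big_mkcond big_allpairs/= mulr_sumr [leRHS]big_mkcond/=.
      apply: ler_sum => u _; case: ifP => [/eqP gu|gu].
        rewrite !mulr_sumr [leRHS]big_mkcond/=; apply: ler_sum => w _.
        by rewrite xpair_eqE gu eqxx/=; case: ifP => // _; rewrite mulrA.
      by rewrite big1// => w _; rewrite xpair_eqE gu.
    have pw0 u : 0 <= \sum_(j <- sJ) cell_mass l' p' (g' u) j `^ q.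
      by apply: sumr_ge0 => j _; apply: powR_ge0.
    apply: (@le_trans _ _ (\sum_(j <- sJ) K `^ q * (cell_mass l p g i `^ (q - 1) *
        \sum_(u <- l | g u == i) p u * cell_mass l' p' (g' u) j `^ q))).
      apply: ler_sum => j _.
      apply: (@le_trans _ _ (K `^ q * (\sum_(u <- l | g u == i)
          p u * cell_mass l' p' (g' u) j) `^ q)).
        rewrite -powRM//; last first.
          by apply: sumr_ge0 => u _; rewrite mulr_ge0// cell_mass_ge0.
        rewrite ge0_ler_powR ?nnegrE ?(ltW q0)//; first exact: cell_mass_ge0.
        by rewrite mulr_ge0// sumr_ge0// => u _; rewrite mulr_ge0// cell_mass_ge0.
      rewrite ler_wpM2l ?powR_ge0// powR_sum_wmean// => u.
      exact: cell_mass_ge0.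
    rewrite -mulr_sumr ler_wpM2l ?powR_ge0// -mulr_sumr.
    rewrite -(@mulr_powRB1 _ (cell_mass l p g i) q) ?cell_mass_ge0//.
    rewrite [X in _ <= X * _]mulrC -mulrA ler_wpM2l ?powR_ge0// exchange_big/=.
    rewrite mulr_suml big_seq_cond [leRHS]big_seq_cond; apply: ler_sum => u /andP[ul _].
    rewrite -mulr_sumr ler_wpM2l// -power_sum_keys ?undup_uniq ?gC//.
    by move=> j /mapP[w wl ->]; rewrite mem_undup; apply/allpairsP; exists (u, w).
  apply: (le_trans (ler_sum _ (fun i _ => step i))).
  by rewrite -mulr_sumr -mulr_suml.
- by apply: allpairs_uniq; rewrite ?undup_uniq// => -[? ?] [? ?].
- move=> _ /mapP[_ /allpairsP[[u w] [ul wl ->]] ->] /=.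
  apply/allpairsP; exists (g u, g' u w); split => //=; rewrite mem_undup ?map_f//.
  by apply/allpairsP; exists (u, w).
Qed.

End Product.

Section Words.
Variable k : nat.

(** As lists, the words of length [n + m] are literally the concatenations, see
    [words_add]. *)
Fixpoint words (n : nat) : seq (seq 'I_k.+1) :=
  if n is n'.+1 then [seq a :: w | a <- enum 'I_k.+1, w <- words n'] else [:: [::]].

Lemma words_add n m : words (n + m) = [seq u ++ w | u <- words n, w <- words m].
Proof.
elim: n => [|n IHn]; first by rewrite add0n /= cats0 map_id.
rewrite addSn /= IHn; elim: (enum 'I_k.+1) => //= a s IHs.
rewrite IHs allpairs_cat; congr (_ ++ _).
by rewrite allpairs_mapl map_allpairs.
Qed.

Lemma size_words n u : u \in words n -> size u = n.
Proof.
by elim: n u => [|n IHn] u /=; [rewrite inE => /eqP->|case/allpairsP => -[a w] [_ /IHn <- ->]].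
Qed.

Lemma mem_words n u : size u = n -> u \in words n.
Proof.
elim: n u => [|n IHn] [|a u] //= [/IHn un].
by apply/allpairsP; exists (a, u); rewrite mem_enum.
Qed.

Lemma words_uniq n : uniq (words n).
Proof.
elim: n => //= n IHn; apply: allpairs_uniq => //; first exact: enum_uniq.
by move=> [a u] [b v] _ _ /= [-> ->].
Qed.

End Words.

(** * Energies of neighbourhoods *)

Section Neighbours.
Variable R : realType.

(** The translated keys are distinct, and those outside the range of [g] have
    mass 0. *)
Lemma power_sum_shift (T : eqType) (J : zmodType) (l : seq T) (p : T -> R) (g : T -> J) q e :
  0 < q ->
  \sum_(j <- undup (map g l)) cell_mass l p g (j + e) `^ q <= power_sum l p g q.
Proof.
move=> q0; set s := undup (map g l).
rewrite (@power_sum_keys _ _ _ _ _ _ _ (undup (s ++ map (+%R^~ e) s))) ?undup_uniq//; last first.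
  by move=> j jl; rewrite mem_undup mem_cat mem_undup jl.
rewrite -(big_map (+%R^~ e) predT (fun j => cell_mass l p g j `^ q)).
set s' := map _ s; have us' : uniq s'.
  by rewrite map_inj_uniq ?undup_uniq//; exact: addIr.
have -> : \sum_(j <- s') cell_mass l p g j `^ q =
    \sum_(j <- undup (s ++ s') | j \in s') cell_mass l p g j `^ q.
  rewrite -[RHS]big_filter; apply: perm_big; apply: uniq_perm => //.
    by rewrite filter_uniq// undup_uniq.
  by move=> j; rewrite mem_filter mem_undup mem_cat; case: (j \in s') => //=; rewrite orbT.
by rewrite [leRHS](bigID (mem s'))/= lerDl sumr_ge0// => j _; exact: powR_ge0.
Qed.

Definition box (A : nat) : seq (int * int) :=
  [seq (i%:Z - A%:Z, j%:Z - A%:Z) | i <- iota 0 A.*2.+1, j <- iota 0 A.*2.+1].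

Lemma mem_box (A : nat) (i : int * int) :
  `|i.1| <= A%:Z -> `|i.2| <= A%:Z -> i \in box A.
Proof.
case: i => a b /= ha hb.
apply/allpairsP; exists (absz (a + A%:Z), absz (b + A%:Z)).
rewrite !mem_iota /=; split; [lia|lia|congr (_, _) => /=; lia].
Qed.

Definition box_near (d : R) (x y : R * R) :=
  (`|x.1 - y.1| <= d) && (`|x.2 - y.2| <= d).

(** A neighbourhood [box_near] may straddle several cells, but it is covered by
    the translates of the cell of its centre by the vectors of [box A]. For each
    translate one uses that [x * y `^ (q - 1)] is at most [x `^ q + y `^ q]. *)
Lemma energy_le_power_sum (T : eqType) (l : seq T) (p : T -> R) (q d : R)
    (F : T -> R * R) (A : nat) : 1 < q <= 2 -> 0 < d -> (forall u, 0 <= p u) ->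
  \sum_(u <- l) p u *
    (\sum_(u' <- l | box_near (A%:R * d) (F u) (F u')) p u') `^ (q - 1) <=
  2 * (A.*2.+1 ^ 2)%:R * power_sum l p (fun u => grid_key d (F u)) q.
Proof.
move=> /andP[q1 q2] d0 p0; have q0 : 0 < q by lra.
pose g u := grid_key d (F u).
pose M := cell_mass l p g.
have M0 j : 0 <= M j by exact: cell_mass_ge0.
have boxS u : \sum_(u' <- l | box_near (A%:R * d) (F u) (F u')) p u' <=
    \sum_(e <- box A) M (g u + e).
  rewrite /M /cell_mass; under [leRHS]eq_bigr do rewrite big_mkcond/=.
  rewrite exchange_big/= big_mkcond/=; apply: ler_sum => u' _.
  have pos s : 0 <= \sum_(e <- s) (if g u' == g u + e then p u' else 0).
    by apply: sumr_ge0 => e _; case: ifP.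
  case: ifP => // /andP[h1 h2].
  have [k1 k2] := grid_key_close d0 h1 h2.
  have eb : g u' - g u \in box A.
    by apply: mem_box; rewrite distrC.
  by rewrite (big_rem _ eb)/= subrKC eqxx lerDl pos.
have boxE e : \sum_(u <- l) p u * M (g u + e) `^ (q - 1) <= 2 * power_sum l p g q.
  rewrite -(@sum_by_key _ _ _ l g (undup (map g l)) (fun u j => p u * M (j + e) `^ (q - 1)))
     ?undup_uniq//; last by move=> j; rewrite mem_undup.
  apply: (@le_trans _ _ (\sum_(j <- undup (map g l)) (M j `^ q + M (j + e) `^ q))); last first.
    by rewrite big_split/= mulr_natl mulr2n lerD2l power_sum_shift.
  apply: ler_sum => j _; rewrite -mulr_suml -/(M j).
  have [h|h] := leP (M j) (M (j + e)).
    rewrite -[leLHS]add0r lerD ?powR_ge0// -[leRHS]mulr_powRB1//.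
    by rewrite ler_wpM2r// powR_ge0.
  rewrite -[leLHS]addr0 lerD ?powR_ge0// -[leRHS]mulr_powRB1//.
  apply: ler_wpM2l; first exact: M0.
  by rewrite ge0_ler_powR ?nnegrE ?(ltW h)//; lra.
apply: (@le_trans _ _ (\sum_(u <- l) \sum_(e <- box A) p u * M (g u + e) `^ (q - 1))).
  apply: ler_sum => u _; rewrite -mulr_sumr; apply: ler_wpM2l => //.
  apply: (@le_trans _ _ ((\sum_(e <- box A) M (g u + e)) `^ (q - 1))).
    rewrite ge0_ler_powR ?nnegrE//; first lra.
      by apply: sumr_ge0.
    by apply: sumr_ge0.
  by apply: powR_sum_le => //; apply/andP; split; lra.
rewrite exchange_big/=.
apply: (le_trans (ler_sum _ (fun e _ => boxE e))).
rewrite big_const_seq count_predT size_allpairs !size_iota -/g.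
by rewrite iter_addr_0 -[leLHS]mulr_natr mulnn mulrAC.
Qed.

End Neighbours.

(** * The plane and its frames *)

Section Plane.
Variable R : realType.
Implicit Types (x y a b : R * R) (s : R).

Lemma dotpBl x y a : dotp (x - y) a = dotp x a - dotp y a.
Proof. by rewrite /dotp /=; ring. Qed.

Lemma dotp_ge0 x : 0 <= dotp x x.
Proof. by rewrite /dotp -!expr2 addr_ge0 ?sqr_ge0. Qed.

Lemma dotp_cauchy x a : dotp x a ^+ 2 <= dotp x x * dotp a a.
Proof.
have := sqr_ge0 (x.1 * a.2 - x.2 * a.1); rewrite /dotp -subr_ge0 => h.
by rewrite -subr_ge0; apply: le_trans h _; rewrite le_eqVlt; apply/orP; left; apply/eqP; ring.
Qed.

Lemma dotp_bound r x a : 0 <= r -> dotp x x <= r ^+ 2 -> dotp a a <= 1 ->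
  `|dotp x a| <= r.
Proof.
move=> r0 xr a1; rewrite -(ler_pXn2r (ltn0Sn 1)) ?nnegrE// real_normK ?num_real//.
by apply: (le_trans (dotp_cauchy x a)); have := dotp_ge0 x; have := dotp_ge0 a; nra.
Qed.

Lemma rotationD s s' x : rotation s (rotation s' x) = rotation (s + s') x.
Proof. by rewrite /rotation sinD cosD /=; congr (_, _); ring. Qed.

Lemma rotation0 x : rotation 0 x = x.
Proof. by case: x => a b; rewrite /rotation sin0 cos0 /=; congr (_, _); ring. Qed.

Lemma iter_rotation s n x : iter n (rotation s) x = rotation (n%:R * s) x.
Proof.
elim: n => [|n IHn] /=; first by rewrite mul0r rotation0.
by rewrite IHn rotationD mulrSr mulrDl mul1r addrC.
Qed.

Lemma dotp_rotation s x y : dotp (rotation s x) y = dotp x (rotation (- s) y).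
Proof. by rewrite /dotp /rotation cosN sinN /=; ring. Qed.

Lemma dotp_rotation2 s x y : dotp (rotation s x) (rotation s y) = dotp x y.
Proof. by rewrite dotp_rotation rotationD addNr rotation0. Qed.

Lemma dotp_similarity (lambda alpha : R) t x a :
  dotp (similarity lambda alpha t x) a =
  dotp t a + lambda * dotp x (rotation (- alpha) a).
Proof. by rewrite -dotp_rotation /dotp /similarity /=; ring. Qed.

(** Paired with a vector, the rotations of the maps become rotations of the
    vector: this is how the directions come to move along an orbit. *)
Lemma dotp_word_map k (lambda alpha : R) (t : 'I_k.+1 -> R * R) u x a :
  let f j := similarity lambda alpha (t j) in
  dotp (word_map f u x) a = dotp (word_map f u (0, 0)) a +
    lambda ^+ size u * dotp x (rotation (- ((size u)%:R * alpha)) a).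
Proof.
move=> f; elim: u x a => [|j u IHu] x a /=.
  by rewrite mul0r oppr0 rotation0 /dotp /=; ring.
rewrite !dotp_similarity IHu rotationD exprS.
by rewrite (_ : - _ + _ = - ((size u).+1%:R * alpha)); [ring|rewrite mulrSr; ring].
Qed.

(** A frame is a pair of vectors. With [std_frame] the coordinates are those of
    the plane, with [line_frame v] they are those of the projection to the
    direction [v], the second one being constant: the plane and its projections
    are treated at once. *)
Definition coords (h : (R * R) * (R * R)) x : R * R := (dotp x h.1, dotp x h.2).

Definition rotate_frame s (h : (R * R) * (R * R)) := (rotation s h.1, rotation s h.2).

Definition in_disk a := dotp a a <= 1.

Definition std_frame : (R * R) * (R * R) := ((1, 0), (0, 1)).

Lemma coords_std_frame x : coords std_frame x = x.
Proof.
by case: x => a b; rewrite /coords /dotp /= !mulr0 !mulr1 addr0 add0r.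
Qed.

Definition line_frame (v : R * R) : (R * R) * (R * R) := (v, (0, 0)).

Lemma in_disk_rotation s a : in_disk (rotation s a) = in_disk a.
Proof. by rewrite /in_disk dotp_rotation2. Qed.

End Plane.

(** * Orbits of an irrational rotation *)

Section Frequency.
Variable R : realType.

Lemma sin_le_id (x : R) : 0 <= x -> sin x <= x.
Proof.
rewrite le_eqVlt => /predU1P[<-|x0]; first by rewrite sin0.
have [c _] := @MVT R sin cos 0 x x0 (fun y _ => is_derive_sin y)
  (continuous_subspaceT (@continuous_sin R)).
rewrite sin0 !subr0 => ->; have := cos_le1 c; nra.
Qed.

(** The mean value theorem, as the cosine is at least 1 / 2 on [0, 1]. *)
Lemma half_le_sin (x : R) : 0 <= x <= 1 -> x / 2 <= sin x.
Proof.
case/andP; rewrite le_eqVlt => /predU1P[<-|x0] x1; first by rewrite sin0 mul0r.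
have [c] := @MVT R sin cos 0 x x0 (fun y _ => is_derive_sin y)
  (continuous_subspaceT (@continuous_sin R)).
rewrite in_itv /= => /andP[c0 cx]; rewrite sin0 !subr0 => ->.
suff : 2^-1 <= cos c by nra.
have -> : cos c = 1 - 2 * (sin (c / 2) * sin (c / 2)).
  rewrite {1}(_ : c = (c / 2) *+ 2); last by rewrite mulr2n -splitr.
  by rewrite cos_mulr2n cos2sin2; ring.
have s1 : sin (c / 2) <= c / 2 by apply: sin_le_id; lra.
have s0 : 0 <= sin (c / 2) by apply: sin_ge0_pi; have := pi_ge2 R; move=> ?; apply/andP; split; lra.
have := ler_pM s0 s0 s1 s1; have : c * c <= 1 by nra.
lra.
Qed.

Lemma norm_sin_addpi (x : R) (z : int) : `|sin (x + z%:~R * pi)| = `|sin x|.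
Proof.
have nat_case y (n : nat) : `|sin (y + n%:R * pi)| = `|sin y|.
  elim: n => [|n IHn]; first by rewrite mul0r addr0.
  by rewrite mulrSr mulrDl mul1r addrA sinDpi normrN.
case: z => n; first exact: nat_case.
by rewrite NegzE -[in RHS](subrK (n.+1%:R * pi) x) nat_case mulrNz mulNr.
Qed.

(** Two of the fractional parts of [0 * x, 1 * x, ..., N * x] lie in the same of
    [N] intervals of length [1 / N]. *)
Lemma dirichlet (x : R) (N : nat) : (0 < N)%N -> exists s (c : int),
  (0 < s)%N /\ `|s%:R * x - c%:~R| < N%:R^-1.
Proof.
move=> N0; have N0' : 0 < N%:R :> R by rewrite ltr0n.
pose fr (i : nat) : R := i%:R * x - (Num.floor (i%:R * x))%:~R.
have fr01 i : 0 <= fr i < 1.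
  have /andP[h1 h2] := floor_itv (i%:R * x).
  by rewrite /fr subr_ge0 h1/=; move: h2; rewrite intrD; lra.
have trN i : (Num.truncn (fr i * N%:R) < N)%N.
  have /andP[h1 h2] := fr01 i.
  have /truncn_itv/andP[h _] : 0 <= fr i * N%:R by rewrite mulr_ge0// ltW.
  by rewrite -(ltr_nat R); apply: le_lt_trans h _; nra.
pose g (i : 'I_N.+1) : 'I_N := Ordinal (trN i).
have : ~~ injectiveb g.
  apply/negP => /injectiveP /leq_card; rewrite !card_ord; lia.
case/injectivePn => i [j ij gij].
wlog ltij : i j ij gij / (i < j)%N.
  move=> H; have [h|h|/val_inj h] := ltngtP i j; first exact: H h.
    by apply: (H j i) => //; rewrite eq_sym.
  by rewrite h eqxx in ij.
exists (j - i)%N, (Num.floor (j%:R * x) - Num.floor (i%:R * x)).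
split; first by rewrite subn_gt0.
have -> : (j - i)%:R * x - (Num.floor (j%:R * x) - Num.floor (i%:R * x))%:~R = fr j - fr i.
  by rewrite natrB ?(ltnW ltij)// intrB /fr; ring.
move/(congr1 val): gij => /= gij.
have bd (k : nat) := @truncn_itv R (fr k * N%:R).
have := bd i; have := bd j; rewrite gij !mulr_ge0 ?(proj1 (andP (fr01 _)))//.
move=> /(_ isT)/andP[a1 a2] /(_ isT)/andP[a3 a4].
rewrite -(ltr_pM2r N0') mulVf ?gt_eqF// -[X in _ * X](ger0_norm (ltW N0')) -normrM mulrBl.
by rewrite ltr_norml; move: a2 a4; rewrite mulrSr; lra.
Qed.

Lemma irrational_neq (x : R) (s : nat) (c : int) : irrational x -> (0 < s)%N ->
  s%:R * x - c%:~R != 0.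
Proof.
move=> irx s0; rewrite subr_eq0; apply/eqP => e; apply: irx.
exists (c%:~R / s%:R) => //=.
rewrite fmorph_div/= ratr_int ratr_nat -e mulrAC mulfV ?mul1r//.
by rewrite pnatr_eq0 -lt0n.
Qed.

(** By [dirichlet] and irrationality some multiple of [x] has a distance to the
    integers that is positive and less than [a]; its own multiples move away
    from the integers by steps of that length. *)
Lemma irrational_window (x a : R) : irrational x -> 0 < a -> exists s (c : int),
  (0 < s)%N /\ a < `|s%:R * x - c%:~R| <= 2 * a.
Proof.
move=> irx a0.
have [s0 [c0 [s00]]] := @dirichlet x (Num.truncn a^-1).+1 isT.
set e := `|_| => e1.
have e0 : 0 < e by rewrite normr_gt0 irrational_neq.
have ea : e < a.
  apply: (lt_trans e1); rewrite -[ltRHS]invrK ltf_pV2 ?posrE ?ltr0n ?invr_gt0//.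
  have /truncn_itv/andP[//] : 0 <= a^-1 by rewrite invr_ge0 ltW.
pose l := (Num.truncn (a / e)).+1.
have /truncn_itv/andP[l1 l2] : 0 <= a / e by rewrite divr_ge0 ?ltW.
exists (l * s0)%N, (l%:Z * c0); split; first by rewrite muln_gt0.
have -> : `|(l * s0)%:R * x - (l%:Z * c0)%:~R| = l%:R * e.
  by rewrite natrM intrM -mulrA -mulrBr normrM ger0_norm.
move: l2; rewrite -/l ltr_pdivrMr// => ->/=.
move: l1; rewrite ler_pdivlMr// /l mulrSr; lra.
Qed.

(** The sine is the determinant of the two rotated vectors, expanded in the
    orthonormal basis formed by [z] and its normal. *)
Lemma rotation_separation (z v : R * R) (b1 b2 d : R) :
  dotp z z = 1 -> dotp v v = 1 ->
  `|dotp z (rotation b1 v)| <= d -> `|dotp z (rotation b2 v)| <= d ->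
  `|sin (b1 - b2)| <= 2 * d.
Proof.
move=> z1 v1.
pose u1 := rotation b1 v; pose u2 := rotation b2 v.
have u11 : dotp u1 u1 = 1 by rewrite dotp_rotation2.
have u22 : dotp u2 u2 = 1 by rewrite dotp_rotation2.
rewrite -/u1 -/u2 => h1 h2.
pose det (x y : R * R) := x.1 * y.2 - x.2 * y.1.
have detle y : dotp y y = 1 -> `|det z y| <= 1.
  move=> y1; rewrite -(expr_le1 (ltn0Sn 1))// real_normK ?num_real//.
  have : det z y ^+ 2 + dotp z y ^+ 2 = dotp z z * dotp y y by rewrite /det /dotp; ring.
  rewrite z1 y1; have := sqr_ge0 (dotp z y); lra.
have -> : sin (b1 - b2) = dotp z u2 * det z u1 - dotp z u1 * det z u2.
  transitivity (dotp z z * (dotp v v * sin (b1 - b2))); first by rewrite z1 v1 !mul1r.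
  by rewrite sinB /det /dotp /u1 /u2 /rotation /=; ring.
apply: (le_trans (ler_normB _ _)); rewrite !normrM.
have := detle _ u11; have := detle _ u22.
have := normr_ge0 (det z u1); have := normr_ge0 (det z u2).
have := normr_ge0 (dotp z u1); have := normr_ge0 (dotp z u2).
nra.
Qed.

(** The translates of [V] by [0, s, ..., (M - 1) * s] are disjoint and lie below
    [a + M * s]. *)
Lemma count_translates (V : seq nat) (a s M : nat) :
  uniq V -> {in V, forall i, (i < a)%N} ->
  {in V &, forall i j l, (0 < l < M)%N -> (j != i + l * s)%N} ->
  (size V * M <= a + M * s)%N.
Proof.
move=> uV Va sep; rewrite -[in leqLHS](size_iota 0 M) -(@size_allpairs _ _ _ (fun i l => (i + l * s)%N)).
rewrite -[leqRHS](size_iota 0); apply: uniq_leq_size.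
  apply: allpairs_uniq => //; first exact: iota_uniq.
  move=> [? ?] [? ?] /allpairsP[[i l] [/= iV + [-> ->]]] /allpairsP[[i' l'] [/= iV' + [-> ->]]] /=.
  rewrite !mem_iota !add0n /= => lM lM' e.
  have [h|h|h] := ltngtP l l'.
  - have lt : (0 < l' - l < M)%N by lia.
    by case/negP: (sep _ _ iV' iV _ lt); apply/eqP; nia.
  - have lt : (0 < l - l' < M)%N by lia.
    by case/negP: (sep _ _ iV iV' _ lt); apply/eqP; nia.
  - by move: e; rewrite h => /addIn ->.
move=> _ /allpairsP[[i l] [/= /Va ia + ->]]; rewrite !mem_iota !add0n /=.
by move=> lM; nia.
Qed.

(** For small [d] there is [s] such that the translates of the set of visiting
    times by [l * s], for [l] less than some [M >= 1 / (16 * d)], are pairwise disjoint: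
    the difference of two visiting times, times [beta], is close to a multiple
    of [pi] by [rotation_separation], whereas [l * s * beta] is not. So the
    visits have density at most [1 / M]. *)
Lemma rotation_frequency (beta d : R) : irrational (beta / pi) -> 0 < d ->
  exists a0 : nat, forall a, (a0 <= a)%N -> forall z v : R * R,
  dotp z z = 1 -> dotp v v = 1 ->
  (count (fun i => `|dotp z (rotation (- (i%:R * beta)) v)| <= d)%R (iota 0 a))%:R
    <= 32 * d * a%:R.
Proof.
move=> irb d0; have pi0 := pi_gt0 R.
(* For large [d] the bound exceeds the number of all times. *)
have [d8|d8] := ltP 8^-1 d.
  exists 0%N => a _ z v _ _.
  apply: (@le_trans _ _ a%:R); first by rewrite ler_nat (leq_trans (count_size _ _))// size_iota.
  by have := ler0n R a; nra.
have [s [c [s0]]] := irrational_window irb (divr_gt0 (mulr_gt0 (ltr0n R 4) d0) pi0).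
set y := _ - _ => /andP[y1 y2].
(* [theta] is the distance from [s * beta] to the multiples of [pi]. It exceeds
   [4 * d], so that the sine of [theta] exceeds [2 * d], and [M * theta <= 1],
   so that the sine is still in the range of [half_le_sin]. *)
pose theta := pi * `|y|.
have th1 : 4 * d < theta by rewrite /theta [pi * _]mulrC -ltr_pdivrMr.
have th2 : theta <= 8 * d.
  have := ler_wpM2l (ltW pi0) y2; rewrite -/theta.
  have E (x : R) : x != 0 -> x * (2 * (4 * d / x)) = 8 * d by move=> ?; field.
  by rewrite E// gt_eqF.
pose M := Num.truncn (8 * d)^-1.
have /truncn_itv/andP[M1 M2] : 0 <= (8 * d)^-1 by rewrite invr_ge0; lra.
have d80 : 0 < 8 * d by lra.
have M0 : (0 < M)%N.
  by rewrite truncn_gt0 -[leLHS]invr1 lef_pV2 ?posrE//; lra.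
have {M1} M1 : M%:R * (8 * d) <= 1 by rewrite -ler_pdivlMr// div1r.
have {M2} M2 : 1 < M.+1%:R * (8 * d) by rewrite -ltr_pdivrMr// div1r.
have sep l : (0 < l < M)%N -> 2 * d < `|sin ((l * s)%:R * beta)|.
  move=> /andP[l0 lM].
  have -> : (l * s)%:R * beta = l%:R * (pi * y) + (l%:Z * c)%:~R * pi.
    rewrite /y natrM intrM -[l%:~R]/(l%:R).
    have E (x : R) : x != 0 -> l%:R * s%:R * beta =
        l%:R * (x * (s%:R * (beta / x) - c%:~R)) + l%:R * c%:~R * x by move=> ?; field.
    by apply: E; rewrite gt_eqF.
  rewrite norm_sin_addpi.
  have -> : `|sin (l%:R * (pi * y))| = `|sin (l%:R * theta)|.
    rewrite /theta; have [y0|y0] := leP 0 y; first by rewrite (ger0_norm y0).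
    by rewrite (ltr0_norm y0) !mulrN sinN normrN.
  have l1 : 1 <= l%:R :> R by rewrite ler1n.
  have lt1 : l%:R * theta <= 1.
    apply: le_trans M1; have : l%:R <= M%:R :> R by rewrite ler_nat ltnW.
    nra.
  have h01 : 0 <= l%:R * theta <= 1 by rewrite lt1 andbT mulr_ge0//; lra.
  have := half_le_sin h01; have := ler_norm (sin (l%:R * theta)); nra.
exists (M * s)%N => a aM z v z1 v1.
rewrite -size_filter; set V := seq.filter _ _.
have := @count_translates V a s M (filter_uniq _ (iota_uniq _ _)).
move=> /(_ _ _)H.
have {H} : (size V * M <= a + M * s)%N.
  apply: H => [i|i j].
    by rewrite mem_filter mem_iota add0n => /andP[_ /andP[]].
  rewrite !mem_filter => /andP[hi _] /andP[hj _] l lM; apply/eqP => e.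
  have := rotation_separation z1 v1 hi hj; rewrite leNgt => /negP; apply.
  rewrite (_ : _ - _ = (l * s)%:R * beta); first exact: sep.
  by rewrite e natrD; ring.
move=> h; have {h} h : (size V)%:R * M%:R <= 2 * a%:R :> R.
  rewrite -!natrM ler_nat; lia.
have M1' : 1 <= M%:R :> R by rewrite ler1n.
have := ler0n R (size V); have := ler0n R a; move: M2 h; rewrite mulrSr.
move: (size V)%:R M%:R a%:R M1' {M1} => x m A m1 h1 h2 A0 x0.
have : 1 <= m * (16 * d) by nra.
nra.
Qed.

End Frequency.

(** * Subadditive sequences and cocycles *)

Section Growth.
Variable R : realType.
Implicit Types (t : nat -> R) (c b X e : R).

(** Only an incomplete block, shorter than [m], is neglected. *)
Lemma block_bound (m : nat) X e : (0 < m)%N -> 0 < e -> exists n0 : nat,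
  forall n, (n0 <= n)%N -> (n %/ m)%:R * (m%:R * X) <= n%:R * (X + e).
Proof.
move=> m0 e0; exists (Num.truncn (m%:R * `|X| / e)).+1 => n.
rewrite -(ler_nat R) => nn.
have /truncn_itv/andP[_ h] : 0 <= m%:R * `|X| / e by rewrite !divr_ge0 ?mulr_ge0 ?(ltW e0).
have {h nn} : m%:R * `|X| <= n%:R * e by rewrite -ler_pdivrMr//; apply: ltW; apply: lt_le_trans h nn.
have -> : (n %/ m)%:R * (m%:R * X) = n%:R * X - (n %% m)%:R * X.
  by rewrite {2}(divn_eq n m) natrD natrM; ring.
have : (n %% m)%:R <= m%:R :> R by rewrite ler_nat ltnW// ltn_mod.
have := ler0n R (n %% m); have := ler_norm (- X); rewrite normrN.
have := normr_ge0 X; nra.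
Qed.

(** The sequence [t n + c] is subadditive, and [L] is the infimum of its
    quotients by [n]. *)
Lemma fekete t c b : (forall n m, t (n + m)%N <= t n + t m + c) ->
  (forall n, t n <= 0) -> (forall n, - (b * n.+1%:R) <= t n) -> 0 <= c ->
  exists L, (forall n, n%:R * L <= t n + c) /\
    forall e, 0 < e -> exists n0 : nat, forall n, (n0 <= n)%N -> t n <= n%:R * (L + e).
Proof.
move=> tD t0 tb c0.
pose A := [set x | exists2 n : nat, (0 < n)%N & x = (t n + c) / n%:R]%classic.
have b0 : 0 <= b by have := tb 0%N; have := t0 0%N; lra.
have iA : has_inf A.
  split; first by exists ((t 1%N + c) / 1%:R); exists 1%N.
  exists (- (b * 2)) => _ [n n0 ->].
  have n1 : 1 <= n%:R :> R by rewrite ler1n.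
  rewrite ler_pdivlMr ?ltr0n//; have := tb n; rewrite mulrSr; nra.
exists (inf A); split=> [n|e e0].
  have [->|n0] := posnP n; first by rewrite mul0r; have := tD 0%N 0%N; rewrite addn0; lra.
  rewrite mulrC -ler_pdivlMr ?ltr0n//; apply: ge_inf; first by case: iA.
  by exists n.
have [_ [m m0 ->] hm] := inf_adherent (divr_gt0 e0 (ltr0n R 2)) iA.
have [n0 hn0] := @block_bound m (inf A + e / 2) (e / 2) m0 (divr_gt0 e0 (ltr0n R 2)).
exists n0 => n nn0; have := hn0 n nn0; rewrite -addrA -splitr; apply: le_trans.
have blocks a r : t (a * m + r)%N <= a%:R * (t m + c).
  elim: a => [|a IHa]; first by rewrite mul0r.
  rewrite mulSn -addnA; apply: (le_trans (tD _ _)).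
  by rewrite mulrSr mulrDl mul1r; lra.
rewrite {1}(divn_eq n m); apply: (le_trans (blocks _ _)).
apply: ler_wpM2l => //; rewrite mulrC -ler_pdivrMr ?ltr0n//.
exact: ltW.
Qed.

(** The orbit is cut into blocks of length [m]; the last, incomplete one
    contributes a nonpositive term. *)
Lemma cocycle_blocks (V : Type) (T : V -> V) (P : V -> Prop) (t : nat -> V -> R) c :
  (forall v, P v -> P (T v)) ->
  (forall n m v, P v -> t (n + m)%N v <= c + t n v + t m (iter n T v)) ->
  (forall n v, P v -> t n v <= 0) ->
  forall (m b a : nat) v, P v ->
    t (a * m + b)%N v <= a%:R * c + \sum_(l <- iota 0 a) t m (iter (l * m) T v).
Proof.
move=> PT tD t0 m b a; rewrite -[a in iota 0 a]subn0 -/(index_iota 0 a).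
have PTi n v : P v -> P (iter n T v) by move=> Pv; elim: n => //= n; exact: PT.
elim: a => [|a IHa] v Pv; first by rewrite big_geq// mul0r addr0 t0.
rewrite mulSn -addnA big_nat_recl// mul0n.
have -> : \sum_(0 <= l < a) t m (iter (l.+1 * m) T v) =
    \sum_(0 <= l < a) t m (iter (l * m) T (iter m T v)).
  by apply: eq_bigr => l _; rewrite -iterD mulSn addnC.
have := tD m (a * m + b)%N v Pv; have := IHa _ (PTi m v Pv).
by rewrite mulrSr /=; lra.
Qed.

(** The inequality between the geometric and the arithmetic mean, in
    logarithmic form: [ln (x / y) <= x / y - 1]. *)
Lemma sum_ln_le (I : eqType) (l : seq I) (x : I -> R) (y : R) : 0 < y ->
  (forall i, 0 < x i) -> \sum_(i <- l) x i <= (size l)%:R * y ->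
  \sum_(i <- l) ln (x i) <= (size l)%:R * ln y.
Proof.
move=> y0 x0 h.
apply: (@le_trans _ _ (\sum_(i <- l) (x i / y - 1 + ln y))).
  apply: ler_sum => i _.
  have := @le_ln1Dx R (x i / y - 1); rewrite subrKC ln_div ?posrE//.
  have : 0 < x i / y by rewrite divr_gt0.
  by move=> xy h1; have := h1 ltac:(lra); lra.
have E (z : R) : \sum_(i <- l) z = (size l)%:R * z.
  by rewrite big_const_seq count_predT iter_addr_0 mulr_natl.
rewrite !big_split/= -mulr_suml !E mulrN1.
have : (\sum_(i <- l) x i) / y <= (size l)%:R by rewrite ler_pdivrMr.
lra.
Qed.

(** A square [n = N ^ 2] is chosen, because the logarithm of its successor is at
    most [2 * N] by elementary means. *)
Lemma sqr_dominates c e : 0 < e -> exists n : nat, (0 < n)%N /\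
  c + ln (n.+1)%:R <= n%:R * e.
Proof.
move=> e0.
pose N := (Num.truncn ((2 + `|c|) / e)).+1.
have N1 : 1 <= N%:R :> R by rewrite ler1n.
have hN : 2 + `|c| <= N%:R * e.
  have /truncn_itv/andP[_ h] : 0 <= (2 + `|c|) / e by rewrite divr_ge0 ?(ltW e0)// addr_ge0.
  by rewrite -ler_pdivrMr// ltW.
exists (N ^ 2)%N; split; first by rewrite expn_gt0.
have : ln (N ^ 2).+1%:R <= 2 * N%:R :> R.
  apply: (@le_trans _ _ (ln ((1 + N%:R) ^+ 2))).
    have N2 : 0 < (1 + N%:R) ^+ 2 :> R by rewrite exprn_gt0//; lra.
    rewrite ler_ln ?posrE ?ltr0n//.
    by rewrite -addn1 natrD natrX sqrrD expr1n mul1r; lra.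
  rewrite lnXn; last lra.
  by rewrite -[leLHS]mulr_natl ler_pM2l// le_ln1Dx//; lra.
rewrite natrX expr2 -mulrA; have := ler_norm c; have := normr_ge0 c.
by have := ler_wpM2l (ler0n R N) hN; nra.
Qed.

Lemma rate_of_bounds (V : Type) (D : V -> Prop) (t : nat -> V -> R) (M c : R) :
  (forall n v, D v -> n%:R * M <= t n v + c) ->
  (forall e, 0 < e -> exists n0 : nat, forall n, (n0 <= n)%N -> forall v, D v ->
     t n v <= n%:R * (M + e)) ->
  forall e, 0 < e -> exists n0 : nat, forall n, (n0 <= n)%N -> forall v, D v ->
     `|t n v - n%:R * M| <= n%:R * e.
Proof.
move=> lo up e e0; have [n0 hn0] := up e e0.
have /truncn_itv/andP[_ hc] : 0 <= `|c| / e by rewrite divr_ge0// ltW.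
exists (maxn n0 (Num.truncn (`|c| / e)).+1) => n; rewrite geq_max => /andP[/hn0 h1 h2] v Dv.
have : `|c| < n%:R * e.
  by rewrite -ltr_pdivrMr//; apply: (lt_le_trans hc); rewrite ler_nat.
have := h1 v Dv; have := lo n v Dv; have := ler_norm c; have := ler0n R n.
by move=> *; rewrite ler_norml; apply/andP; split; lra.
Qed.

(** Passage from the scales [lambda ^+ n] to the scales [2 ^- N], where
    [rho = - ln lambda], [l2 = ln 2] and [lambda ^+ n N] is comparable to
    [2 ^- N]; the bounded error [c] vanishes after the division by [N]. *)
Lemma rate_transfer (V : Type) (D : V -> Prop) (t s : nat -> V -> R)
    (n : nat -> nat) (M c rho l2 Q : R) : 0 < rho -> 0 < l2 -> 0 < Q -> 0 <= c ->
  (forall N, N%:R * l2 <= (n N)%:R * rho <= N%:R * l2 + rho) ->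
  (forall N v, D v -> `|s N v - t (n N) v| <= c) ->
  (forall e, 0 < e -> exists n0 : nat, forall m, (n0 <= m)%N -> forall v, D v ->
     `|t m v - m%:R * M| <= m%:R * e) ->
  forall e, 0 < e -> exists N0 : nat, forall N, (N0 <= N)%N -> forall v, D v ->
    `|M / (- rho * Q) - s N v / l2 / - (N%:R * Q)| < e.
Proof.
move=> rho0 l20 Q0 c0 nN st tM e e0.
pose e1 := e * (rho * Q) / 3.
have e10 : 0 < e1 by rewrite divr_gt0// !mulr_gt0.
have [n0 hn0] := tM e1 e10.
pose C := rho * c + e1 * rho + `|M| * rho.
have C0 : 0 <= C by rewrite !addr_ge0// mulr_ge0// ltW.
pose N1 := (Num.truncn (n0%:R * rho / l2)).+1.
pose N2 := (Num.truncn (C / (e1 * l2))).+1.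
have /truncn_itv/andP[_ hN1] : 0 <= n0%:R * rho / l2 by rewrite divr_ge0 ?mulr_ge0// ltW.
have /truncn_itv/andP[_ hN2] : 0 <= C / (e1 * l2) by rewrite divr_ge0 ?mulr_ge0// ltW.
exists (maxn N1 N2) => N; rewrite geq_max => /andP[NN1 NN2] v Dv.
have N0 : 0 < N%:R :> R by rewrite ltr0n (leq_trans _ NN1).
have {}hN1 : n0%:R * rho < N%:R * l2.
  by rewrite -ltr_pdivrMr//; apply: (lt_le_trans hN1); rewrite ler_nat.
have {}hN2 : C < N%:R * (e1 * l2).
  by rewrite -ltr_pdivrMr ?mulr_gt0//; apply: (lt_le_trans hN2); rewrite ler_nat.
have /andP[h1 h2] := nN N.
have n0n : (n0 <= n N)%N by rewrite -(ler_nat R) -(ler_pM2r rho0) ltW// (lt_le_trans hN1).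
have ht := hn0 _ n0n v Dv; have hs := st N v Dv.
have -> : M / (- rho * Q) - s N v / l2 / - (N%:R * Q) =
    (rho * s N v - M * (N%:R * l2)) / (rho * Q * (N%:R * l2)).
  by field; rewrite !gt_eqF.
have P0 : 0 < rho * Q * (N%:R * l2) by rewrite !mulr_gt0.
rewrite normrM normfV (gtr0_norm P0) ltr_pdivrMr//.
have -> : rho * s N v - M * (N%:R * l2) = rho * (s N v - t (n N) v) +
    (rho * (t (n N) v - (n N)%:R * M) + M * ((n N)%:R * rho - N%:R * l2)) by ring.
apply: (le_lt_trans (ler_normD _ _)).
apply: (@le_lt_trans _ _ (rho * c + (rho * ((n N)%:R * e1) + `|M| * rho))).
  rewrite lerD//; first by rewrite normrM (gtr0_norm rho0) ler_pM2l.
  apply: (le_trans (ler_normD _ _)); rewrite lerD//.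
    by rewrite normrM (gtr0_norm rho0) ler_pM2l.
  by rewrite normrM ler_wpM2l// ger0_norm; lra.
have -> : e * (rho * Q * (N%:R * l2)) = 3 * (N%:R * (e1 * l2)) by rewrite /e1; field.
have : rho * ((n N)%:R * e1) <= e1 * (N%:R * l2 + rho).
  by rewrite mulrC -mulrA [e1 * rho]mulrC mulrA mulrC ler_pM2l.
have := mulr_gt0 N0 (mulr_gt0 e10 l20).
rewrite /C in hN2; lra.
Qed.

End Growth.

(** * Grid sums, submultiplicativity and orbit averages *)

Section Cascade.
Variables (R : realType) (k : nat) (lambda alpha : R) (t : 'I_k.+1 -> R * R).
Variables (r K q : R) (p : seq 'I_k.+1 -> R).

Let f j := similarity lambda alpha (t j).
Let point u := word_map f u (0, 0).

Hypothesis lam01 : 0 < lambda < 1.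
Hypothesis r0 : 0 < r.
Hypothesis K1 : 1 < K.
Hypothesis q12 : 1 < q <= 2.
Hypothesis fB : forall j x, dotp x x <= r ^+ 2 -> dotp (f j x) (f j x) <= r ^+ 2.
Hypothesis p0 : forall u, 0 <= p u.
Hypothesis pnil : p [::] = 1.
Hypothesis p_rcons : forall u, \sum_(a <- enum 'I_k.+1) p (rcons u a) = p u.
Hypothesis p_cat : forall u w, p (u ++ w) <= K * p u * p w.

(** The length of the words is tied to the scale of the grid: the points of the
    words of length [n] describe the measure up to the scale [lambda ^+ n]. *)
Definition grid_sum n (h : (R * R) * (R * R)) : R :=
  power_sum (words k n) p (fun u => grid_key (lambda ^+ n) (coords h (point u))) q.

Let q1 : 1 <= q. Proof. by case/andP: q12 => /ltW. Qed.
Let q0 : 0 < q. Proof. exact: lt_le_trans ltr01 q1. Qed.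
Let q10 : 0 <= q - 1. Proof. by rewrite subr_ge0. Qed.
Let lam0 n : 0 < lambda ^+ n. Proof. by rewrite exprn_gt0//; case/andP: lam01. Qed.

Lemma sum_words u m : \sum_(w <- words k m) p (u ++ w) = p u.
Proof.
elim: m u => [|m IHm] u /=; first by rewrite big_seq1 cats0.
rewrite big_allpairs_dep/= -[RHS]p_rcons; apply: eq_bigr => a _.
by rewrite -[RHS]IHm; apply: eq_bigr => w _; rewrite cat_rcons.
Qed.

Lemma sum_words1 n : \sum_(u <- words k n) p u = 1.
Proof. by rewrite -pnil -(sum_words [::] n). Qed.

Lemma word_map_ball u x : dotp x x <= r ^+ 2 ->
  dotp (word_map f u x) (word_map f u x) <= r ^+ 2.
Proof. by move=> xr; elim: u => //= j u IHu; exact: fB. Qed.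

Lemma point_ball u : dotp (point u) (point u) <= r ^+ 2.
Proof. by apply: word_map_ball; rewrite /dotp !mul0r addr0 sqr_ge0. Qed.

Lemma point_cat u w a : dotp (point (u ++ w)) a = dotp (point u) a +
  lambda ^+ size u * dotp (point w) (rotation (- ((size u)%:R * alpha)) a).
Proof. by rewrite /point /word_map foldr_cat -/(word_map _ _ _) dotp_word_map. Qed.

Lemma point_cat_close u w a : in_disk a ->
  `|dotp (point (u ++ w)) a - dotp (point u) a| <= lambda ^+ size u * r.
Proof.
move=> a1; rewrite point_cat addrAC subrr add0r.
rewrite normrM (ger0_norm (ltW (lam0 _))) ler_pM2l//.
apply: dotp_bound; rewrite ?(ltW r0)//; first exact: point_ball.
by rewrite -/(in_disk _) in_disk_rotation.
Qed.

Lemma grid_sum_le1 n h : grid_sum n h <= 1.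
Proof. by apply: power_sum_le1 => //; exact: sum_words1. Qed.

Lemma grid_sum_cmp n h h' (A B : nat) :
  (forall x, `|dotp x h.1| <= lambda ^+ n -> `|dotp x h.2| <= lambda ^+ n ->
     `|dotp x h'.1| <= A%:R * lambda ^+ n /\ `|dotp x h'.2| <= B%:R * lambda ^+ n) ->
  grid_sum n h <= (A.*2.+1 * B.*2.+1)%:R `^ (q - 1) * grid_sum n h'.
Proof.
move=> hh'; apply: power_sum_grid_cmp => // u u' _ _.
by rewrite /= -!dotpBl; exact: hh'.
Qed.

(** Differences that are at most [d] in the coordinates of an orthonormal frame
    are at most [2 * d] in those of another one, so that a cell meets at most
    5 by 5 cells of the other grid. *)
Lemma grid_sum_rotate n s :
  grid_sum n (rotate_frame s (std_frame R)) <= 25%:R `^ (q - 1) * grid_sum n (std_frame R).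
Proof.
apply: (@grid_sum_cmp _ _ _ 2 2) => x /=.
rewrite -[rotation s _]/(_, _) -[rotation s (0, 1)]/(_, _) /dotp /=.
have := cos2Dsin2 s; move: (cos s) (sin s) (lambda ^+ n) (lam0 n) => c d l l0 cd.
rewrite !mulr1 !mulr0 !addr0 !subr0 !add0r => h1 h2.
have c1 : `|c| <= 1 by rewrite -(expr_le1 (ltn0Sn 1))// real_normK ?num_real//; have := sqr_ge0 d; lra.
have d1 : `|d| <= 1 by rewrite -(expr_le1 (ltn0Sn 1))// real_normK ?num_real//; have := sqr_ge0 c; lra.
have e1 : x.1 = c * (x.1 * c + x.2 * d) - d * (x.1 * - d + x.2 * c).
  by rewrite -[LHS]mulr1 -cd; ring.
have e2 : x.2 = d * (x.1 * c + x.2 * d) + c * (x.1 * - d + x.2 * c).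
  by rewrite -[LHS]mulr1 -cd; ring.
have bnd a b y z : `|a| <= 1 -> `|b| <= 1 -> `|y| <= l -> `|z| <= l -> `|a * y + b * z| <= 2 * l.
  move=> ha hb hy hz; apply: (le_trans (ler_normD _ _)); rewrite !normrM.
  have := normr_ge0 a; have := normr_ge0 b; have := normr_ge0 y; have := normr_ge0 z; nra.
split; [rewrite e1 -mulNr|rewrite e2]; apply: bnd; rewrite ?normrN//.
Qed.

(** The projection of a cell of the plane meets at most five intervals: no
    projection can increase the dimension. *)
Lemma grid_sum_std_line n v : in_disk v ->
  grid_sum n (std_frame R) <= 5%:R `^ (q - 1) * grid_sum n (line_frame v).
Proof.
move=> v1; apply: (@grid_sum_cmp _ _ _ 2 0) => x /=.
rewrite /dotp /= !mulr0 !mulr1 !addr0 add0r normr0 mul0r => h1 h2; split => //.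
move: v1; rewrite /in_disk /dotp -!expr2 => v1.
have a1 : `|v.1| <= 1 by rewrite -(expr_le1 (ltn0Sn 1))// real_normK ?num_real//; have := sqr_ge0 v.2; lra.
have b1 : `|v.2| <= 1 by rewrite -(expr_le1 (ltn0Sn 1))// real_normK ?num_real//; have := sqr_ge0 v.1; lra.
apply: (le_trans (ler_normD _ _)); rewrite !normrM.
have := normr_ge0 v.1; have := normr_ge0 v.2; have := normr_ge0 x.1; have := normr_ge0 x.2; nra.
Qed.

(** Comparison with the partition into a single cell, whose sum is 1. *)
Lemma grid_sum_lower n h (A B : nat) : (forall u, `|dotp (point u) h.1| <= A%:R / 2 * lambda ^+ n) ->
  (forall u, `|dotp (point u) h.2| <= B%:R / 2 * lambda ^+ n) ->
  1 <= (A.*2.+1 * B.*2.+1)%:R `^ (q - 1) * grid_sum n h.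
Proof.
move=> hA hB.
have := @power_sum_grid_cmp _ _ (words k n) p q (fun=> (0, 0)) (fun u => coords h (point u)) 1
  (lambda ^+ n) A B q1 p0 ltr01 (lam0 n).
set T := power_sum _ _ _ _.
have -> : T = 1.
  rewrite /T power_sum_energy//.
  rewrite (eq_bigr p) ?sum_words1// => u _.
  rewrite (_ : cell_mass _ _ _ _ = 1) ?powR1 ?mulr1//.
  by rewrite -(sum_words1 n) /cell_mass; apply: eq_bigl => w; rewrite eqxx.
apply => u u' _ _ _ _ /=; split; apply: (le_trans (ler_normB _ _)).
  by have := hA u; have := hA u'; lra.
by have := hB u; have := hB u'; lra.
Qed.

(** The points have coordinates in an interval of length [2 * r]. *)
Let ncells n := (Num.truncn (2 * r / lambda ^+ n)).+1.

Let ncells_ge0 n : 0 <= 2 * r / lambda ^+ n.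
Proof. by rewrite divr_ge0 ?mulr_ge0 ?(ltW r0) ?(ltW (lam0 n)). Qed.

Let ncells_point n u a : in_disk a -> `|dotp (point u) a| <= (ncells n)%:R / 2 * lambda ^+ n.
Proof.
move=> a1; have := dotp_bound (ltW r0) (point_ball u) a1.
have /andP[_] := truncn_itv (ncells_ge0 n).
by rewrite ltr_pdivrMr// -/(ncells n); lra.
Qed.

Let lam_le1 n : lambda ^+ n <= 1.
Proof. by case/andP: lam01 => l0 l1; rewrite exprn_ile1// ltW. Qed.

Let ncells_le n : (ncells n).*2.+1%:R <= (4 * r + 3) / lambda ^+ n.
Proof.
have /andP[h _] := truncn_itv (ncells_ge0 n).
rewrite ler_pdivlMr//; move: h; rewrite ler_pdivlMr// /ncells.
move: (Num.truncn _) => N h; have := lam_le1 n.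
rewrite -addn1 -muln2 natrD natrM [N.+1%:R]mulrSr.
have := lam0 n; lra.
Qed.

(** The mass is spread over [O(lambda ^- n)] intervals: the dimension of a
    projection is at most 1. *)
Lemma grid_sum_line_lower n v : in_disk v ->
  (lambda ^+ n) `^ (q - 1) <= (4 * r + 3) `^ (q - 1) * grid_sum n (line_frame v).
Proof.
move=> v1.
have h : 1 <= (ncells n).*2.+1%:R `^ (q - 1) * grid_sum n (line_frame v).
  rewrite -[_.*2.+1]muln1; apply: (@grid_sum_lower _ _ _ 0) => u /=.
    exact: ncells_point.
  by rewrite /dotp /= !mulr0 addr0 normr0 !mul0r.
rewrite -[leLHS]mulr1; apply: (le_trans (ler_wpM2l (powR_ge0 _ _) h)).
rewrite mulrA -powRM ?(ltW (lam0 n))// ler_wpM2r ?power_sum_ge0//.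
rewrite ge0_ler_powR ?nnegrE//.
- by rewrite mulr_ge0// ltW.
- by have := r0; lra.
by rewrite mulrC -ler_pdivlMr// ncells_le.
Qed.

Lemma grid_sum_std_lower n :
  ((lambda ^+ n) ^+ 2) `^ (q - 1) <= ((4 * r + 3) ^+ 2) `^ (q - 1) * grid_sum n (std_frame R).
Proof.
have h : 1 <= ((ncells n).*2.+1 * (ncells n).*2.+1)%:R `^ (q - 1) * grid_sum n (std_frame R).
  by apply: grid_sum_lower => u; apply: ncells_point; rewrite /in_disk /dotp /=; lra.
rewrite -[leLHS]mulr1; apply: (le_trans (ler_wpM2l (powR_ge0 _ _) h)).
rewrite mulrA -powRM ?sqr_ge0// ler_wpM2r ?power_sum_ge0//.
rewrite ge0_ler_powR ?nnegrE ?sqr_ge0//.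
  by rewrite mulr_ge0// sqr_ge0.
rewrite natrM -expr2 -exprMn ler_pXn2r ?nnegrE//.
- by rewrite mulrC -ler_pdivlMr// ncells_le.
- by rewrite mulr_ge0// ltW.
- by have := r0; lra.
Qed.

(** Points of words with the same prefix [u] differ by at most
    [lambda ^+ size u * r] in each coordinate. If two points are in one cell of
    a finer grid, then the points of their prefixes differ by at most [blur]
    cells of the grid of scale [lambda ^+ size u]. *)
Let blur := (Num.truncn (1 + 2 * r)).+1.
Let blurP : 1 + 2 * r <= blur%:R.
Proof. have /truncn_itv/andP[_ /ltW//] : 0 <= 1 + 2 * r by have := r0; lra. Qed.

(** Quasi-submultiplicativity: the part of the measure carried by the words
    that start with [u] is dominated by [p u] times a copy of the whole
    measure, scaled by [lambda ^+ size u] and rotated. *)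
Lemma grid_sum_submul : exists2 C, 1 <= C &
  forall n m h, in_disk h.1 -> in_disk h.2 ->
  grid_sum (n + m) h <=
    C * grid_sum n h * grid_sum m (rotate_frame (- (n%:R * alpha)) h).
Proof.
pose N : R := (blur.*2.+1 * blur.*2.+1)%:R `^ (q - 1).
have one_le M : (0 < M)%N -> 1 <= M%:R `^ (q - 1) :> R.
  by move=> M0; rewrite -[leLHS](powRr0 M%:R) ler_powR// ler1n.
exists (N * (K `^ q * 9%:R `^ (q - 1))).
  have Kq : 1 <= K `^ q by rewrite -[leLHS](powRr0 K) ler_powR ?(ltW K1)// ltW.
  by rewrite !mulr_ege1// one_le.
move=> n m h h1 h2.
pose coarse u := grid_key (lambda ^+ n) (coords h (point u)).
pose fine u w := grid_key (lambda ^+ (n + m)) (coords h (point (u ++ w))).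
pose pp (uw : seq 'I_k.+1 * seq 'I_k.+1) := p (uw.1 ++ uw.2).
have words_prod : words k (n + m) =
    map (fun uw => uw.1 ++ uw.2) [seq (u, w) | u <- words k n, w <- words k m].
  by rewrite words_add map_allpairs.
rewrite /grid_sum words_prod power_sum_map -!mulrA.
apply: (@le_trans _ _ (N * power_sum [seq (u, w) | u <- words k n, w <- words k m]
    pp (fun uw => (coarse uw.1, fine uw.1 uw.2)) q)).
  (* A fine cell meets few coarse cells. *)
  apply: power_sum_cmp => [//|uw|i]; first exact: p0.
  rewrite -size_filter; set s := seq.filter _ _.
  have sP j : j \in s -> j.2 = i /\ exists uw, [/\ uw.1 \in words k n, uw.2 \in words k m,
      fine uw.1 uw.2 = i & coarse uw.1 = j.1].
    rewrite mem_filter => /andP[/hasP[_ /allpairsP[[u w] [/= un wm ->]] /=]].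
    by move=> /andP[/eqP fi /eqP <-] _; split; last exists (u, w).
  have us : uniq (map fst s).
    rewrite map_inj_in_uniq ?filter_uniq ?undup_uniq// => -[a b] [c d].
    by move=> /sP[/= -> _] /sP[/= -> _] ->.
  rewrite -(size_map fst).
  have : all (mem (map fst s)) (map fst s) by apply/allP.
  rewrite all_count => /eqP <-; apply: count_close => //.
  have close u u' w w' a : in_disk a -> u \in words k n -> u' \in words k n ->
      `|dotp (point (u ++ w)) a - dotp (point (u' ++ w')) a| <= lambda ^+ (n + m) ->
      `|dotp (point u) a - dotp (point u') a| <= blur%:R * lambda ^+ n.
    move=> a1 un un'; have := point_cat_close u w a1; have := point_cat_close u' w' a1;
      rewrite (size_words un) (size_words un').
    have : lambda ^+ (n + m) <= lambda ^+ n.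
      by rewrite exprD -[leRHS]mulr1 ler_pM2l.
    have := ler_wpM2r (ltW (lam0 n)) blurP.
    by rewrite !ler_norml; move=> ? ? /andP[? ?] /andP[? ?] /andP[? ?]; apply/andP; split; lra.
  move=> _ _ /mapP[j1 /sP[_ [[u w] [/= un _ fi <-]] ->]] /mapP[j2 /sP[_ [[u' w'] [/= un' _ fi' <-]] ->]].
  have [c1 c2] := grid_key_eq (lam0 _) (etrans fi (esym fi')).
  exact: (@grid_key_close _ _ (coords h (point u)) (coords h (point u')) blur blur (lam0 n)
    (close u u' w w' _ h1 un un' c1) (close u u' w w' _ h2 un un' c2)).
apply: ler_wpM2l; first exact: powR_ge0.
apply: (le_trans (@power_sum_product R _ _ _ _ (words k n) (words k m) p p pp coarse fine q K
  (9%:R `^ (q - 1) * grid_sum m (rotate_frame (- (n%:R * alpha)) h)) q1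
  (ltW (lt_trans ltr01 K1)) p0 p0 (fun uw => p0 _) p_cat _)).
- (* For a fixed prefix [u] the fine cells are those of the rotated frame, up to
     a translation of the grid; hence the 9 = 3 * 3. *)
  move=> u un; apply: (@power_sum_grid_cmp _ _ _ _ _ _ _ _ _ 1 1) => // w w' _ _.
  rewrite /coords/= !point_cat (size_words un).
  have E (c b y z : R) : (c + b * y) - (c + b * z) = b * (y - z) by ring.
  rewrite !E !normrM !(ger0_norm (ltW (lam0 n))).
  by rewrite exprD !ler_pM2l// !mul1r.
by rewrite [X in _ * X]mulrCA.
Qed.

Lemma power_sum_take (J : eqType) j m (g : seq 'I_k.+1 -> J) :
  power_sum (words k (j + m)) p (fun u => g (take j u)) q = power_sum (words k j) p g q.
Proof.
have sub : {subset [seq g (take j u) | u <- words k (j + m)] <= undup (map g (words k j))}.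
  rewrite words_add => _ /mapP[_ /allpairsP[[u w] [/= uj _ ->]] ->].
  by rewrite mem_undup take_size_cat ?(size_words uj)// map_f.
rewrite (power_sum_keys _ q0 (undup_uniq _) sub).
apply: eq_bigr => i _; congr (_ `^ _).
rewrite /cell_mass big_mkcond words_add big_allpairs_dep/= [RHS]big_mkcond/=.
rewrite big_seq [RHS]big_seq; apply: eq_bigr => u uj.
rewrite -(sum_words u m); under eq_bigr do rewrite take_size_cat ?(size_words uj)//.
by case: ifP => // _; rewrite big1.
Qed.

(** With this the grid sums of all scales [lambda ^+ j], [j <= m], can be
    computed with the words of the single length [m]. *)
Lemma coarse_power_sum h : in_disk h.1 -> in_disk h.2 -> forall j m,
  power_sum (words k (j + m)) p
    (fun u => grid_key (lambda ^+ j) (coords h (point u))) q <=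
  (blur.*2.+1 * blur.*2.+1)%:R `^ (q - 1) * grid_sum j h.
Proof.
move=> h1 h2 j m; rewrite /grid_sum -(power_sum_take j m).
apply: power_sum_grid_cmp => // u u' uw uw'.
have E v : v \in words k (j + m) -> exists2 w, v = take j v ++ w & size (take j v) = j.
  move=> /size_words sv; exists (drop j v); first by rewrite cat_take_drop.
  by rewrite size_takel// sv leq_addr.
have [w ew su] := E _ uw; have [w' ew' su'] := E _ uw'.
have close a : in_disk a ->
    `|dotp (point u) a - dotp (point u') a| <= lambda ^+ j ->
    `|dotp (point (take j u)) a - dotp (point (take j u')) a| <= blur%:R * lambda ^+ j.
  move=> a1; have := point_cat_close (take j u) w a1; rewrite su -ew.
  have := point_cat_close (take j u') w' a1; rewrite su' -ew'.
  have := ler_wpM2r (ltW (lam0 j)) blurP.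
  by rewrite !ler_norml; move=> ? /andP[? ?] /andP[? ?] /andP[? ?]; apply/andP; split; lra.
by move=> c1 c2; split; apply: close.
Qed.

Let diam := (Num.truncn (2 * r)).+1.
Let diamP : 2 * r <= diam%:R.
Proof. have /truncn_itv/andP[_ /ltW//] : 0 <= 2 * r by have := r0; lra. Qed.

Let neighbours m j u :=
  \sum_(u' <- words k m | box_near (diam%:R * lambda ^+ j) (point u) (point u')) p u'.

Lemma energy_neighbours : exists2 C, 0 < C & forall m j, (j <= m)%N ->
  \sum_(u <- words k m) p u * neighbours m j u `^ (q - 1) <= C * grid_sum j (std_frame R).
Proof.
exists (2 * (diam.*2.+1 ^ 2)%:R * (blur.*2.+1 * blur.*2.+1)%:R `^ (q - 1)).
  by rewrite !mulr_gt0 ?powR_gt0 ?ltr0n ?muln_gt0 ?expn_gt0.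
move=> m j jm; rewrite -(subnKC jm).
apply: (le_trans (@energy_le_power_sum R _ _ p q (lambda ^+ j) point diam q12 (lam0 j) p0)).
rewrite -[leRHS]mulrA; apply: ler_wpM2l; first by rewrite mulr_ge0.
have := @coarse_power_sum (std_frame R) _ _ j (m - j).
rewrite /in_disk /dotp /= !mulr0 !mulr1 add0r addr0 => /(_ (lexx 1) (lexx 1)).
apply: le_trans; rewrite /power_sum le_eqVlt; apply/orP; left; apply/eqP.
have E : (fun u => grid_key (lambda ^+ j) (point u)) =
    (fun u => grid_key (lambda ^+ j) (coords (std_frame R) (point u))).
  by apply/funext => u; rewrite coords_std_frame.
by rewrite -E.
Qed.

Let in_box j (z : R * R) : bool := (`|z.1| <= diam%:R * lambda ^+ j) && (`|z.2| <= diam%:R * lambda ^+ j).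

Lemma rotation_frequency_uniform (beta : R) (ds : seq R) : irrational (beta / pi) ->
  (forall d, d \in ds -> 0 < d) ->
  exists a0 : nat, forall a, (a0 <= a)%N -> forall d, d \in ds -> forall z v : R * R,
  dotp z z = 1 -> dotp v v = 1 ->
  (count (fun i => `|dotp z (rotation (- (i%:R * beta)) v)| <= d)%R (iota 0 a))%:R
    <= 32 * d * a%:R.
Proof.
move=> irb; elim: ds => [_|d ds IHds ds0]; first by exists 0%N.
have [|a1 h1] := IHds; first by move=> e ed; apply: ds0; rewrite inE ed orbT.
have [a2 h2] := rotation_frequency irb (ds0 d (mem_head _ _)).
exists (maxn a1 a2) => a; rewrite geq_max => /andP[aa1 aa2] e.
by rewrite inE => /predU1P[->|ed]; [exact: h2|exact: h1].
Qed.

Let freqC := 1 + 16 / (r * lambda).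

(** If [|z|] is about [r * lambda ^+ j], then the projection of [z] is at most
    [lambda ^+ m] only for directions in a double arc of size
    [O(lambda ^+ (m - j))] around the normal of [z], and [rotation_frequency]
    bounds the visits to it. The sum collects the cases. *)
Lemma frequency_small_projection (beta : R) m : irrational (beta / pi) ->
  exists a0 : nat, forall a, (a0 <= a)%N -> forall z v : R * R,
  dotp z z <= (2 * r) ^+ 2 -> dotp v v = 1 ->
  (count (fun i => `|dotp z (rotation (- (i%:R * beta)) v)| <= lambda ^+ m)%R (iota 0 a))%:R
    <= freqC * a%:R * \sum_(j <- iota 0 m.+1) lambda ^+ (m - j) * (in_box j z)%:R.
Proof.
move=> irb; have /andP[l0 l1] := lam01; have rp := r0.
pose d j := lambda ^+ m / (2 * r * lambda ^+ j.+1).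
have [e|a0 freq] := @rotation_frequency_uniform beta (map d (iota 0 m)) irb.
  by move=> /mapP[j _ ->]; rewrite divr_gt0// !mulr_gt0.
exists a0 => a aa0 z v z2 v1.
pose P i := dotp z z <= (2 * r * lambda ^+ i) ^+ 2.
have in_boxP j : P j -> in_box j z.
  move=> Pj; have zb w : dotp w w <= 1 -> `|dotp z w| <= diam%:R * lambda ^+ j.
    move=> w1; apply: (@le_trans _ _ (2 * r * lambda ^+ j)).
      by apply: dotp_bound => //; rewrite !mulr_ge0// ltW.
    by rewrite ler_wpM2r ?diamP// ltW.
  have := zb (1, 0); have := zb (0, 1); rewrite /dotp /= !mulr0 !mulr1 !add0r !addr0.
  by move=> /(_ (lexx _)) h2 /(_ (lexx _)) h1; rewrite /in_box h1.
have term_ge0 j : 0 <= lambda ^+ (m - j) * (in_box j z)%:R.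
  by rewrite mulr_ge0 ?ler0n ?(ltW (lam0 _)).
have term_le j : (j <= m)%N -> lambda ^+ (m - j) * (in_box j z)%:R <=
    \sum_(j <- iota 0 m.+1) lambda ^+ (m - j) * (in_box j z)%:R.
  move=> jm; rewrite (bigD1_seq j) ?iota_uniq ?mem_iota//=.
  by rewrite lerDl sumr_ge0.
have C1 : 1 <= freqC by rewrite /freqC lerDl divr_ge0// mulr_ge0// ltW.
have a00 : 0 <= a%:R :> R by [].
have [Pm|nPm] := boolP (P m).
  apply: (@le_trans _ _ a%:R); first by rewrite ler_nat (leq_trans (count_size _ _))// size_iota.
  rewrite -mulrA -[leLHS]mul1r ler_pM// -[leLHS]mulr1 ler_wpM2l//.
  by apply: le_trans (term_le m _); rewrite // subnn in_boxP// mulr1.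
(* [j] is the last scale with [|z| <= 2 * r * lambda ^+ j]. *)
have [] := @ex_minnP (fun i => ~~ P i); first by exists m.
move=> [|j]; first by rewrite /P expr0 mulr1 z2.
move=> nPj minj; have jm : (j < m)%N by exact: minj.
have Pj : P j by apply: contraT => /minj; rewrite ltnn.
have nz0 : 0 <= 2 * r * lambda ^+ j.+1 by rewrite !mulr_ge0 ?(ltW (lam0 _))// ltW.
pose nz := Num.sqrt (dotp z z).
have zn : 2 * r * lambda ^+ j.+1 < nz.
  by rewrite -(ltr_pXn2r (ltn0Sn 1)) ?nnegrE ?sqrtr_ge0// sqr_sqrtr ?dotp_ge0// ltNge.
have nzp : 0 < nz by exact: le_lt_trans zn.
pose z' := (z.1 / nz, z.2 / nz).
have z'1 : dotp z' z' = 1.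
  have e : nz * nz = dotp z z by rewrite -expr2 sqr_sqrtr// dotp_ge0.
  rewrite (_ : dotp z' z' = dotp z z / (nz * nz)); first by rewrite -e mulfV// mulf_neq0// gt_eqF.
  by rewrite /dotp /z' /=; field; rewrite gt_eqF.
have z'E w : dotp z w = nz * dotp z' w.
  by rewrite /dotp /z' /=; field; rewrite gt_eqF.
apply: (@le_trans _ _ (32 * d j * a%:R)).
  apply: le_trans (freq a aa0 (d j) _ z' v z'1 v1); last by rewrite map_f// mem_iota.
  rewrite ler_nat; apply: sub_count => i /=.
  rewrite z'E normrM (gtr0_norm nzp) => h.
  rewrite /d ler_pdivlMr ?mulr_gt0//.
  by apply: le_trans h; rewrite mulrC ler_wpM2r// ltW.
rewrite [leRHS]mulrAC ler_wpM2r//.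
apply: (@le_trans _ _ (freqC * (lambda ^+ (m - j) * (in_box j z)%:R))); last first.
  by apply: ler_wpM2l; [exact: le_trans ler01 C1|exact: term_le (ltnW jm)].
rewrite (in_boxP _ Pj) mulr1 /d -{1}(subnK (ltnW jm)) exprD exprS.
rewrite (_ : 32 * _ = 16 / (r * lambda) * lambda ^+ (m - j)); last first.
  by field; rewrite !gt_eqF.
by rewrite ler_wpM2r ?(ltW (lam0 _))// /freqC lerDr.
Qed.

(** Marstrand's projection theorem for the average over an orbit instead of the
    average over all directions. As [q - 1 <= 1], concavity moves the average
    inside the energy, where [frequency_small_projection] turns the frequency of
    small projections of [x - y] into the kernel
    [lambda ^+ m / |x - y|], decomposed into scales. *)
Lemma orbit_average : exists2 C, 0 < C & forall m (beta : R), irrational (beta / pi) ->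
  exists a0 : nat, forall a, (a0 <= a)%N -> forall v : R * R, dotp v v = 1 ->
  \sum_(l <- iota 0 a) grid_sum m (line_frame (rotation (- (l%:R * beta)) v)) <=
  a%:R * (C * \sum_(j <- iota 0 m.+1) (lambda ^+ (m - j)) `^ (q - 1) * grid_sum j (std_frame R)).
Proof.
have [C C0 enC] := energy_neighbours.
have q11 : 0 < q - 1 <= 1 by case/andP: q12 => ? ?; apply/andP; split; lra.
have q11' : 0 <= q - 1 <= 1 by case/andP: q11 => /ltW -> ->.
have F0 : 0 < freqC.
  by have /andP[l0 l1] := lam01; rewrite /freqC addr_gt0// divr_gt0// mulr_gt0.
exists (freqC `^ (q - 1) * C); first by rewrite mulr_gt0// powR_gt0.
move=> m beta irb; have [a0 freq] := frequency_small_projection m irb.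
exists a0.+1 => a aa0 v v1.
have ap : 0 < a%:R :> R by rewrite ltr0n (leq_trans _ aa0).
pose vl l := rotation (- (l%:R * beta)) v.
pose chi l u u' := `|dotp (point u - point u') (vl l)| <= lambda ^+ m.
pose S l u := \sum_(u' <- words k m | chi l u u') p u'.
have S0 l u : 0 <= S l u by apply: sumr_ge0.
have N0 j u : 0 <= neighbours m j u by apply: sumr_ge0.
have step1 l : grid_sum m (line_frame (vl l)) <= \sum_(u <- words k m) p u * S l u `^ (q - 1).
  rewrite /grid_sum power_sum_energy//; apply: ler_sum => u _; apply: ler_wpM2l => //.
  rewrite ge0_ler_powR ?nnegrE ?cell_mass_ge0//.
  rewrite /cell_mass /S big_mkcond [leRHS]big_mkcond/=; apply: ler_sum => u' _.
  case: ifP => [/eqP gu|_]; last by case: ifP.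
  have [h _] := grid_key_eq (lam0 m) (esym gu).
  by rewrite /chi dotpBl h.
have step2 u : \sum_(l <- iota 0 a) S l u `^ (q - 1) <=
    a%:R * (\sum_(l <- iota 0 a) a%:R^-1 * S l u) `^ (q - 1).
  rewrite mulrC -ler_pdivrMr// mulrC mulr_sumr.
  apply: wmean_powR_sum => //.
  rewrite big_const_seq count_predT size_iota iter_addr_0 -[LHS]mulr_natr mulVf//.
  by rewrite gt_eqF.
have step3 u : \sum_(l <- iota 0 a) a%:R^-1 * S l u <=
    freqC * \sum_(j <- iota 0 m.+1) lambda ^+ (m - j) * neighbours m j u.
  rewrite -mulr_sumr mulrC ler_pdivrMr// /S.
  under eq_bigr do rewrite big_mkcond/=.
  rewrite exchange_big/=.
  apply: (@le_trans _ _ (\sum_(u' <- words k m) p u' *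
     (freqC * a%:R * \sum_(j <- iota 0 m.+1) lambda ^+ (m - j) *
        (in_box j (point u - point u'))%:R))).
    apply: ler_sum => u' _.
    rewrite -big_mkcond/= big_const_seq iter_addr_0 -[leLHS]mulr_natr; apply: ler_wpM2l => //.
    apply: freq => //; first exact: ltnW.
    have := dotp_cauchy (point u) (point u').
    have := point_ball u; have := point_ball u'.
    have := dotp_ge0 (point u); have := dotp_ge0 (point u').
    rewrite (_ : dotp (point u - point u') _ =
      dotp (point u) (point u) + dotp (point u') (point u') - 2 * dotp (point u) (point u')); last first.
      by rewrite /dotp /=; ring.
    move: (dotp (point u) (point u)) (dotp (point u') (point u')) (dotp (point u) (point u')) => x y z y0 x0 yr xr zr.
    have z1 : `|z| <= r ^+ 2.
      rewrite -(ler_pXn2r (ltn0Sn 1)) ?nnegrE ?sqr_ge0// real_normK ?num_real//.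
      by rewrite (le_trans zr)// expr2 ler_pM.
    by move: z1; rewrite ler_norml exprMn => /andP[z1 z2]; lra.
  have -> : \sum_(j <- iota 0 m.+1) lambda ^+ (m - j) * neighbours m j u =
      \sum_(u' <- words k m) p u' *
        \sum_(j <- iota 0 m.+1) lambda ^+ (m - j) * (in_box j (point u - point u'))%:R.
    under [RHS]eq_bigr do rewrite mulr_sumr.
    rewrite [RHS]exchange_big/=; apply: eq_bigr => j _.
    rewrite /neighbours big_mkcond mulr_sumr/=; apply: eq_bigr => u' _.
    rewrite mulrCA -[box_near _ _ _]/(in_box j (point u - point u')).
    by case: (in_box j _); rewrite ?mulr1 ?mulr0.
  rewrite mulrAC mulr_sumr; apply: ler_sum => u' _.
  by rewrite [leRHS]mulrCA.
apply: (le_trans (ler_sum _ (fun l _ => step1 l))).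
rewrite exchange_big/=.
apply: (@le_trans _ _ (\sum_(u <- words k m) p u * (a%:R * (freqC `^ (q - 1) *
   \sum_(j <- iota 0 m.+1) (lambda ^+ (m - j)) `^ (q - 1) * neighbours m j u `^ (q - 1))))).
  apply: ler_sum => u _; rewrite -mulr_sumr; apply: ler_wpM2l => //.
  apply: (le_trans (step2 u)); apply: ler_wpM2l; first exact: ltW.
  have T0 j : 0 <= lambda ^+ (m - j) * neighbours m j u.
    by apply: mulr_ge0 => //; exact: ltW.
  apply: (@le_trans _ _ ((freqC * \sum_(j <- iota 0 m.+1)
      lambda ^+ (m - j) * neighbours m j u) `^ (q - 1))).
    rewrite ge0_ler_powR ?nnegrE ?step3//.
      by apply: sumr_ge0 => l _; rewrite mulr_ge0// invr_ge0 ltW.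
    by rewrite mulr_ge0 ?(ltW F0)// sumr_ge0.
  rewrite powRM ?(ltW F0) ?sumr_ge0//; apply: ler_wpM2l; first exact: powR_ge0.
  apply: (le_trans (powR_sum_le _ _ q11 T0)); apply: ler_sum => j _.
  by rewrite powRM// ltW.
rewrite (_ : \sum_(u <- words k m) _ = a%:R * (freqC `^ (q - 1) *
    \sum_(j <- iota 0 m.+1) (lambda ^+ (m - j)) `^ (q - 1) *
      \sum_(u <- words k m) p u * neighbours m j u `^ (q - 1))); last first.
  under eq_bigr do rewrite mulrCA [X in _ * X]mulrCA.
  rewrite -!mulr_sumr; congr (_ * (_ * _)).
  under eq_bigr do rewrite mulr_sumr.
  rewrite exchange_big/=; apply: eq_bigr => j _; rewrite mulr_sumr.
  by apply: eq_bigr => u _; rewrite mulrCA.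
rewrite ler_wpM2l ?(ltW ap)// -mulrA; apply: ler_wpM2l; first exact: powR_ge0.
rewrite mulr_sumr big_seq [leRHS]big_seq; apply: ler_sum => j.
rewrite mem_iota add0n ltnS /= => jm; rewrite [leRHS]mulrCA.
by apply: ler_wpM2l; [exact: powR_ge0|exact: enC].
Qed.

Let std1 : in_disk (std_frame R).1.
Proof. by rewrite /in_disk /dotp /= mulr0 mulr1 addr0. Qed.
Let std2 : in_disk (std_frame R).2.
Proof. by rewrite /in_disk /dotp /= mulr0 mulr1 add0r. Qed.
Let r43 : 0 < 4 * r + 3. Proof. by have := r0; lra. Qed.

Lemma grid_sum_line_gt0 n v : in_disk v -> 0 < grid_sum n (line_frame v).
Proof.
move=> v1; have := grid_sum_line_lower n v1.
have : 0 < (lambda ^+ n) `^ (q - 1) by rewrite powR_gt0.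
by move=> /lt_le_trans H /H; rewrite pmulr_rgt0// powR_gt0.
Qed.

Lemma grid_sum_std_gt0 n : 0 < grid_sum n (std_frame R).
Proof.
have := grid_sum_std_lower n.
have : 0 < ((lambda ^+ n) ^+ 2) `^ (q - 1) by rewrite powR_gt0// exprn_gt0.
by move=> /lt_le_trans H /H; rewrite pmulr_rgt0// powR_gt0// exprn_gt0.
Qed.

(** Fekete's lemma applies, because the rotated frame of [grid_sum_submul] can
    be replaced by the standard one at the cost of a constant. *)
Lemma grid_sum_std_limit : exists L c : R,
  (forall n, n%:R * L <= ln (grid_sum n (std_frame R)) + c) /\
  forall e, 0 < e -> exists n0 : nat, forall n, (n0 <= n)%N ->
    ln (grid_sum n (std_frame R)) <= n%:R * (L + e).
Proof.
have [C C1 submul] := grid_sum_submul.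
pose c := ln C + (q - 1) * ln 25.
have C0 : 0 < C by exact: lt_le_trans C1.
have c0 : 0 <= c by rewrite addr_ge0 ?mulr_ge0 ?ln_ge0//; lra.
pose b := `|(q - 1) * (ln ((4 * r + 3) ^+ 2))| + `|(q - 1) * 2 * ln lambda|.
have [||n||L [hL1 hL2]] := @fekete R (fun n => ln (grid_sum n (std_frame R))) c b.
- move=> n m; have S0 := grid_sum_std_gt0 n; have S1 := grid_sum_std_gt0 m.
  have P0 : 0 < 25%:R `^ (q - 1) :> R by rewrite powR_gt0.
  apply: (@le_trans _ _ (ln (C * grid_sum n (std_frame R) *
      (25%:R `^ (q - 1) * grid_sum m (std_frame R))))); last first.
    move: S0 S1; move: (grid_sum n _) (grid_sum m _) => x y x0 y0.
    by rewrite !lnM ?posrE ?mulr_gt0// ln_powR /c; lra.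
  rewrite ler_ln ?posrE ?mulr_gt0 ?grid_sum_std_gt0//.
  apply: (le_trans (submul n m _ std1 std2)).
  by apply: ler_wpM2l; [rewrite mulr_ge0// ltW|exact: grid_sum_rotate].
- by move=> n; rewrite ln_le0// grid_sum_le1.
- have := grid_sum_std_lower n.
  have l2 : 0 < lambda ^+ n ^+ 2 by rewrite exprn_gt0.
  have r2 : 0 < (4 * r + 3) ^+ 2 by rewrite exprn_gt0.
  rewrite -ler_ln ?posrE ?mulr_gt0 ?powR_gt0 ?grid_sum_std_gt0//.
  rewrite lnM ?posrE ?powR_gt0 ?grid_sum_std_gt0// !ln_powR lnXn// lnXn; last by case/andP: lam01.
  have := ler_norm ((q - 1) * ln ((4 * r + 3) ^+ 2)).
  have := ler_norm (- ((q - 1) * 2 * ln lambda)); rewrite normrN.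
  have := normr_ge0 ((q - 1) * ln ((4 * r + 3) ^+ 2)).
  have := normr_ge0 ((q - 1) * 2 * ln lambda).
  rewrite /b mulrSr; have := ler0n R n.
  rewrite -[_ *+ 2]mulr_natr -[_ *+ n]mulr_natr.
  move: (`|_|) (`|_|) => x y; nra.
- by [].
by exists L, c.
Qed.

Lemma line_frame_rotation (s : R) (v : R * R) : rotate_frame s (line_frame v) = line_frame (rotation s v).
Proof. by rewrite /rotate_frame /line_frame /rotation /= !mulr0 subr0 addr0. Qed.

(** Along blocks of length [m] the sums are bounded by a product over the orbit
    of the rotation by [m%:R * alpha], hence, by the inequality between the
    geometric and the arithmetic mean, by a power of the orbit average. *)
Lemma grid_sum_line_upper (L : R) : irrational (alpha / pi) ->
  (forall e, 0 < e -> exists n0 : nat, forall n, (n0 <= n)%N ->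
    ln (grid_sum n (std_frame R)) <= n%:R * (L + e)) ->
  forall e, 0 < e -> exists n0 : nat, forall n, (n0 <= n)%N ->
  forall v, dotp v v = 1 ->
  ln (grid_sum n (line_frame v)) <= n%:R * (Num.max L ((q - 1) * ln lambda) + e).
Proof.
move=> irr hL e' e'0; set M := Num.max _ _.
pose e := e' / 3; have e0 : 0 < e by rewrite divr_gt0.
have [C C1 submul] := grid_sum_submul.
have C0 : 0 < C by exact: lt_le_trans C1.
have [C' C'0 avg] := orbit_average.
have l0 : 0 < lambda by case/andP: lam01.
have [n1 hn1] := hL e e0.
(* [c1] accounts for the scales below [n1]. *)
pose c1 := n1%:R * `|L + e|.
have c10 : 0 <= c1 by rewrite mulr_ge0.
have lnT j : ln (grid_sum j (std_frame R)) <= j%:R * (L + e) + c1.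
  have [/hn1|jn1] := leqP n1 j; first by lra.
  have : ln (grid_sum j (std_frame R)) <= 0 by rewrite ln_le0// grid_sum_le1.
  have : j%:R <= n1%:R :> R by rewrite ler_nat ltnW.
  rewrite /c1; have := ler_norm (- (L + e)); rewrite normrN.
  have := ler0n R j; have := normr_ge0 (L + e); nra.
(* The block length [m] makes the constants, divided by [m], less than [e]. *)
have [m [m0 hm]] := sqr_dominates (ln C + ln C' + c1) e0.
pose Y := C' * (m.+1%:R * expR (m%:R * (M + e) + c1)).
have Y0 : 0 < Y by rewrite !mulr_gt0// expR_gt0.
have lnY : ln C + ln Y <= m%:R * (M + e + e).
  rewrite /Y !lnM ?posrE ?mulr_gt0 ?expR_gt0// expRK; lra.
have sumY : C' * (\sum_(j <- iota 0 m.+1) (lambda ^+ (m - j)) `^ (q - 1) *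
    grid_sum j (std_frame R)) <= Y.
  rewrite ler_pM2l//.
  have -> : m.+1%:R * expR (m%:R * (M + e) + c1) =
      \sum_(j <- iota 0 m.+1) expR (m%:R * (M + e) + c1).
    by rewrite big_const_seq count_predT size_iota iter_addr_0 mulr_natl.
  rewrite big_seq [leRHS]big_seq; apply: ler_sum => j.
  rewrite mem_iota add0n ltnS /= => jm.
  have T0 := grid_sum_std_gt0 j.
  rewrite -[leLHS]lnK ?posrE ?mulr_gt0 ?powR_gt0// ler_expR.
  rewrite lnM ?posrE ?powR_gt0// ln_powR lnXn// -[ln _ *+ _]mulr_natr natrB//.
  have := lnT j.
  have LM : L <= M by rewrite le_max lexx.
  have lM : (q - 1) * ln lambda <= M by rewrite le_max lexx orbT.
  have : j%:R <= m%:R :> R by rewrite ler_nat.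
  have := ler0n R j; nra.
have irm : irrational (m%:R * alpha / pi).
  move=> [x _ xe]; apply: irr; exists (x / m%:R) => //.
  rewrite fmorph_div/= xe ratr_nat mulrC -!mulrA mulKf// pnatr_eq0.
  by rewrite gtn_eqF.
have [a0 ha] := avg m _ irm.
pose tau n v := ln (grid_sum n (line_frame v)).
have blocks : forall b a v, dotp v v = 1 -> tau (a * m + b)%N v <=
    a%:R * ln C + \sum_(l <- iota 0 a) tau m (iter (l * m) (rotation (- alpha)) v).
  apply: (@cocycle_blocks R _ _ (fun v => dotp v v = 1)) => [v v1|n n' v v1|n v v1].
  - by rewrite dotp_rotation2.
  - have disk s : in_disk (rotation s v) by rewrite /in_disk dotp_rotation2 v1.
    rewrite iter_rotation mulrN /tau.
    have := submul n n' (line_frame v); rewrite line_frame_rotation /= {1 2}/in_disk v1.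
    rewrite /dotp /= !mulr0 addr0 => /(_ (lexx 1) ler01).
    have := grid_sum_line_gt0 n (disk 0); rewrite rotation0.
    have := grid_sum_line_gt0 n' (disk (- (n%:R * alpha))).
    have := grid_sum_line_gt0 (n + n') (disk 0); rewrite rotation0.
    move: (grid_sum _ _) (grid_sum n _) (grid_sum n' _) => x y z x0 z0 y0 xyz.
    by rewrite -!lnM ?posrE ?mulr_gt0// ler_ln ?posrE ?mulr_gt0.
  - by rewrite /tau ln_le0// grid_sum_le1.
have [n2 hn2] := @block_bound R m (M + e + e) e m0 e0.
exists (maxn n2 (a0 * m)) => n; rewrite geq_max => /andP[/hn2 h2 n3] v v1.
rewrite (_ : M + e' = M + e + e + e); last by rewrite /e; lra.
apply: le_trans h2.
rewrite {1}(divn_eq n m); apply: (le_trans (blocks _ _ v v1)).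
have aa0 : (a0 <= n %/ m)%N by rewrite leq_divRL.
apply: (@le_trans _ _ ((n %/ m)%:R * ln C + (n %/ m)%:R * ln Y)).
  rewrite lerD2l -[X in X%:R * ln Y](size_iota 0).
  apply: sum_ln_le => //.
    by move=> l; apply: grid_sum_line_gt0; rewrite /in_disk iter_rotation dotp_rotation2 v1.
  rewrite size_iota; apply: (@le_trans _ _ ((n %/ m)%:R * (C' *
    (\sum_(j <- iota 0 m.+1) (lambda ^+ (m - j)) `^ (q - 1) * grid_sum j (std_frame R))))).
    apply: le_trans (ha _ aa0 v v1); apply: ler_sum => l _.
    by rewrite iter_rotation mulrN natrM mulrA.
  by apply: ler_wpM2l.
by rewrite -mulrDr; apply: ler_wpM2l.
Qed.

(** The two terms of the maximum come from [grid_sum_std_line] and from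
    [grid_sum_line_lower]. *)
Lemma grid_sum_line_lower_log (L c : R) :
  (forall n, n%:R * L <= ln (grid_sum n (std_frame R)) + c) ->
  exists c' : R, forall n v, in_disk v ->
    n%:R * Num.max L ((q - 1) * ln lambda) <= ln (grid_sum n (line_frame v)) + c'.
Proof.
move=> hL; exists (`|c| + (q - 1) * ln 5 + `|(q - 1) * ln (4 * r + 3)|) => n v v1.
have T0 := grid_sum_line_gt0 n v1; have T1 := grid_sum_std_gt0 n.
have ln5 : 0 <= (q - 1) * ln 5 by rewrite mulr_ge0// ln_ge0//; lra.
have [_|_] := leP L ((q - 1) * ln lambda).
  have := grid_sum_line_lower n v1.
  rewrite -ler_ln ?posrE ?mulr_gt0 ?powR_gt0//.
  rewrite lnM ?posrE ?powR_gt0// !ln_powR lnXn; last by case/andP: lam01.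
  rewrite -[ln lambda *+ n]mulr_natl mulrCA.
  have := ler_norm ((q - 1) * ln (4 * r + 3)); have := normr_ge0 c.
  move: (ln (grid_sum _ _)) => x; lra.
have := grid_sum_std_line n v1.
rewrite -ler_ln ?posrE ?mulr_gt0 ?powR_gt0// lnM ?posrE ?powR_gt0// ln_powR.
have := hL n; have := ler_norm c; have := normr_ge0 ((q - 1) * ln (4 * r + 3)).
move: (ln (grid_sum _ _)) (ln (grid_sum _ _)) => x y; lra.
Qed.

End Cascade.

(** * The space of infinite words *)

Local Open Scope classical_set_scope.
Local Open Scope ring_scope.

Section WordSpace.
Variable k : nat.
Implicit Types (A : set (word_space k)) (w : word_space k) (u : seq 'I_k.+1).

Lemma measurable_coordinate n (a : 'I_k.+1) :
  measurable ([set w : word_space k | w n = a]).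
Proof.
apply: sub_gen_smallest.
pose X := discrete_topology 'I_k.+1.
have H := @proj_continuous nat (fun=> X) n.
apply: (@open_comp (prod_topology (fun _ : nat => X : topologicalType)) X
  (fun w => w n) [set (a : X)] (fun w _ => H w)).
exact: discrete_open.
Qed.

Lemma measurable_cylinder u : measurable (cylinder u).
Proof.
have -> : cylinder u = [set w : word_space k | forall i, (i < size u)%N -> w i = nth ord0 u i].
  apply/seteqP; split=> w /=; rewrite /cylinder/=.
    by move=> wu i iu; rewrite -[u in RHS]wu nth_mkseq.
  move=> wu; apply: (@eq_from_nth _ ord0); rewrite size_mkseq// => i iu.
  by rewrite nth_mkseq// wu.
elim: (size u) => [|n IHn].
  rewrite (_ : [set _ | _] = setT); first exact: measurableT.
  by apply/seteqP; split.
rewrite (_ : [set _ | _] = [set w : word_space k | forall i, (i < n)%N -> w i = nth ord0 u i] `&`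
    [set w | w n = nth ord0 u n]).
  by apply: measurableI => //; exact: measurable_coordinate.
apply/seteqP; split=> w /=.
  by move=> h; split=> [i iN|]; apply: h => //; exact: ltnW.
move=> [h1 h2] i lei; have [lti|gei] := ltnP i n; first exact: h1.
by have -> : i = n by lia.
Qed.

(** Such a set is the union of the cylinders that it contains, and there are
    countably many finite words. *)
Lemma measurable_cylinder_open A :
  (forall w, A w -> exists n, cylinder (mkseq w n) `<=` A) -> measurable A.
Proof.
move=> oA.
have -> : A = \bigcup_(u : seq 'I_k.+1)
    (if `[< cylinder u `<=` A >] then cylinder u else set0).
  apply/seteqP; split=> w.
    move=> Aw; have [n cA] := oA w Aw; exists (mkseq w n) => //; rewrite asboolT//.
    by rewrite /cylinder /= size_mkseq.
  by move=> [u _]; case: asboolP => // cA /cA.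
apply: countable_bigcupT_measurable; first exact: countableP.
by move=> u; case: asboolP => _; [exact: measurable_cylinder|exact: measurable0].
Qed.

Variables (R : realType) (P : probability (word_space k) R).

Lemma fine_measureDI (A B : set (word_space k)) : measurable A -> measurable B ->
  fine (P A) = fine (P (A `\` B)) + fine (P (A `&` B)).
Proof.
move=> mA mB; rewrite -fineD ?fin_num_measure//.
- by rewrite -measureDI.
- exact: measurableD.
- exact: measurableI.
Qed.

Lemma fine_measure_ge0 A : 0 <= fine (P A).
Proof. exact: fine_ge0. Qed.

Lemma fine_measure_by_key (J : choiceType) (s : seq J) (G : word_space k -> J) A :
  uniq s -> measurable A -> (forall j, measurable [set w | G w = j]) ->
  (forall w, A w -> G w \in s) ->
  fine (P A) = \sum_(j <- s) fine (P (A `&` [set w | G w = j])).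
Proof.
elim: s A => [|j s IHs] A.
  move=> _ _ _ h; rewrite big_nil (_ : A = set0) ?measure0//.
  by apply/seteqP; split=> // w /h.
move=> /= /andP[js us] mA mG h.
rewrite big_cons addrC (fine_measureDI mA (mG j)); congr (_ + _).
rewrite (IHs (A `\` [set w | G w = j])) //; last first.
- by move=> w [/h]; rewrite inE => /predU1P[].
- exact: measurableD.
rewrite big_seq [RHS]big_seq; apply: eq_bigr => i is_.
congr (fine (P _)); apply/seteqP; split=> w /=.
  by move=> [[Aw _] <-].
move=> [Aw Gw]; split => //; split => // Gj.
by move: js; rewrite -Gj Gw is_.
Qed.

Definition cylinder_mass u := fine (P (cylinder u)).

Lemma cylinder_mass_nil : cylinder_mass [::] = 1.
Proof.
rewrite /cylinder_mass (_ : cylinder [::] = setT) ?probability_setT//.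
by apply/seteqP; split.
Qed.

Lemma cylinder_mass_rcons u :
  \sum_(a <- enum 'I_k.+1) cylinder_mass (rcons u a) = cylinder_mass u.
Proof.
rewrite [RHS](@fine_measure_by_key _ (enum 'I_k.+1) (fun w => w (size u))).
- apply: eq_bigr => a _; congr (fine (P _)).
  apply/seteqP; split=> w; rewrite /cylinder /= size_rcons mkseqS.
    by move=> /rcons_inj[-> ->].
  by move=> [-> ->].
- exact: enum_uniq.
- exact: measurable_cylinder.
- by move=> j; exact: measurable_coordinate.
- by move=> w _; rewrite mem_enum.
Qed.

Lemma cylinder_mass_cat (K : R) : 0 <= K ->
  (forall u v : seq 'I_k.+1, (P (cylinder (u ++ v)) <=
     K%:E * P (cylinder u) * P (cylinder v))%E) ->
  forall u v, cylinder_mass (u ++ v) <= K * cylinder_mass u * cylinder_mass v.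
Proof.
move=> K0 PK u v; have := PK u v.
have fin (s : seq 'I_k.+1) : P (cylinder s) = (cylinder_mass s)%:E.
  by rewrite /cylinder_mass fineK// fin_num_measure//; exact: measurable_cylinder.
by rewrite !fin -!EFinM lee_fin.
Qed.

End WordSpace.

(** * The coding map *)

Section Coding.
Variables (R : realType) (k : nat) (lambda alpha : R) (t : 'I_k.+1 -> R * R) (r : R).

Let f j := similarity lambda alpha (t j).
Let point u := word_map f u (0, 0).
Let B := eclosed_ball r.

Hypothesis lam01 : 0 < lambda < 1.
Hypothesis r0 : 0 < r.
Hypothesis fB : forall j x, dotp x x <= r ^+ 2 -> dotp (f j x) (f j x) <= r ^+ 2.

Let lam0 n : 0 < lambda ^+ n. Proof. by rewrite exprn_gt0//; case/andP: lam01. Qed.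

Lemma eclosed_ballE x : B x <-> dotp x x <= r ^+ 2.
Proof.
rewrite /B /eclosed_ball /enorm /=.
rewrite -(ler_pXn2r (ltn0Sn 1)) ?nnegrE ?sqrtr_ge0 ?(ltW r0)//.
by rewrite sqr_sqrtr ?dotp_ge0.
Qed.

Lemma exprn_small e : 0 < e -> exists n, lambda ^+ n < e.
Proof.
move=> e0; have /andP[l0 l1] := lam01.
have h : `|lambda| < 1 by rewrite gtr0_norm.
have /cvgrPdist_lt/(_ e e0)[n _ /(_ n (leqnn n))] := cvg_expr h.
by rewrite sub0r normrN gtr0_norm//; exists n.
Qed.

Lemma similarity_onto j x : exists y, f j y = x.
Proof.
exists (rotation (- alpha) ((x.1 - (t j).1) / lambda, (x.2 - (t j).2) / lambda)).
rewrite /f /similarity rotationD addrN rotation0 /=.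
case: x => a b /=; congr (_, _); rewrite mulrC divfK ?subrK// gt_eqF//;
  by case/andP: lam01.
Qed.

Lemma word_map_onto u x : exists y, word_map f u y = x.
Proof.
elim: u x => [|j u IHu] x; first by exists x.
by have [y <-] := similarity_onto j x; have [z <-] := IHu y; exists z.
Qed.

Lemma word_map_dist u y :
  let D := word_map f u y - point u in
  dotp D D = (lambda ^+ size u) ^+ 2 * dotp y y.
Proof.
move=> D; pose y' := rotation ((size u)%:R * alpha) y.
have DE a : dotp D a = lambda ^+ size u * dotp y' a.
  by rewrite dotpBl (dotp_word_map _ _ _ u y) addrAC subrr add0r -dotp_rotation.
have dC (x z : R * R) : dotp x z = dotp z x by rewrite /dotp mulrC [x.2 * _]mulrC.
by rewrite DE dC DE /y' dotp_rotation2 expr2 mulrA.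
Qed.

Lemma point_prefix w n m a : in_disk a -> (n <= m)%N ->
  `|dotp (point (mkseq w m)) a - dotp (point (mkseq w n)) a| <= lambda ^+ n * r.
Proof.
move=> a1 nm; rewrite -(cat_take_drop n (mkseq w m)).
have -> : take n (mkseq w m) = mkseq w n.
  by rewrite /mkseq -map_take take_iota (minn_idPl nm).
move: (drop _ _) => v; rewrite /point /word_map foldr_cat -!/(word_map _ _ _).
rewrite (dotp_word_map _ _ _ (mkseq w n)) addrAC subrr add0r size_mkseq.
rewrite normrM (gtr0_norm (lam0 n)) ler_pM2l//.
apply: dotp_bound; [exact: ltW| |by rewrite -/(in_disk _) in_disk_rotation].
elim: v => [|j v IHv] /=; first by rewrite /dotp /= !mulr0 addr0 sqr_ge0.
exact: fB.
Qed.

(** [l] is the supremum of the left end points [x n - c n]. *)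
Lemma nested_intervals (x c : nat -> R) :
  (forall n m, (n <= m)%N -> `|x m - x n| <= c n) ->
  exists l, forall n, `|l - x n| <= c n.
Proof.
move=> xc; pose A := [set x n - c n | n in setT].
have c0 n : 0 <= c n by exact: le_trans (normr_ge0 _) (xc n n (leqnn n)).
have ub n : ubound A (x n + c n).
  move=> _ [m _ <-]; have [nm|mn] := leqP n m.
    by have := xc _ _ nm; have := c0 m; rewrite ler_norml => ? /andP[? ?]; lra.
  by have := xc _ _ (ltnW mn); have := c0 n; rewrite ler_norml => ? /andP[? ?]; lra.
have A0 : A !=set0 by exists (x 0%N - c 0%N); exists 0%N.
have supA : has_sup A by split => //; exists (x 0%N + c 0%N).
exists (sup A) => n; rewrite ler_norml.
have h1 : sup A <= x n + c n by apply: ge_sup => //; exact: ub.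
have h2 : x n - c n <= sup A by apply: ub_le_sup; [case: supA|exists n].
by apply/andP; split; lra.
Qed.

(** The images of the ball along the prefixes of a word are nested discs with
    centres [point (mkseq w n)] and radii [lambda ^+ n * r]. A point [l] whose
    coordinates are limits of those of the centres belongs to all of them, so
    the intersection that defines [coding] is not empty. *)
Lemma coding_word_map w n : exists2 y, dotp y y <= r ^+ 2 &
  coding f B w = word_map f (mkseq w n) y.
Proof.
pose c n := lambda ^+ n * r.
have disk1 : in_disk ((1, 0) : R * R) by rewrite /in_disk /dotp /= mulr0 mulr1 addr0.
have disk2 : in_disk ((0, 1) : R * R) by rewrite /in_disk /dotp /= mulr0 mulr1 add0r.
have [l1 hl1] := @nested_intervals (fun n => dotp (point (mkseq w n)) (1, 0)) c
  (fun n m nm => point_prefix w disk1 nm).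
have [l2 hl2] := @nested_intervals (fun n => dotp (point (mkseq w n)) (0, 1)) c
  (fun n m nm => point_prefix w disk2 nm).
pose l := (l1, l2).
have close n' a : in_disk a -> `|dotp (l - point (mkseq w n')) a| <= c n'.
  move=> a1; apply/ler_addgt0Pr => e e0.
  have [m hm] : exists m, lambda ^+ m < e / (4 * r) by apply: exprn_small; rewrite divr_gt0// mulr_gt0.
  pose M := maxn m n'.
  have lM : lambda ^+ M * r <= e / 4.
    have : lambda ^+ M <= lambda ^+ m.
      by case/andP: lam01 => ? ?; rewrite ler_wiXn2l ?leq_maxl// ltW.
    move: hm; rewrite ltr_pdivlMr ?mulr_gt0//; have := r0; nra.
  have := point_prefix w a1 (leq_maxr m n'); rewrite -/M => h.
  have a11 : `|a.1| <= 1.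
    by have := dotp_bound ler01 _ disk1 (x := a); rewrite expr1n => /(_ a1); rewrite /dotp /= mulr1 mulr0 addr0.
  have a21 : `|a.2| <= 1.
    by have := dotp_bound ler01 _ disk2 (x := a); rewrite expr1n => /(_ a1); rewrite /dotp /= mulr1 mulr0 add0r.
  have -> : dotp (l - point (mkseq w n')) a =
      (l1 - dotp (point (mkseq w M)) (1, 0)) * a.1 + (l2 - dotp (point (mkseq w M)) (0, 1)) * a.2
      + (dotp (point (mkseq w M)) a - dotp (point (mkseq w n')) a).
    by rewrite /dotp /=; ring.
  apply: (le_trans (ler_normD _ _)); rewrite addrC lerD//.
  apply: (le_trans (ler_normD _ _)); rewrite !normrM.
  have := ler_pM (normr_ge0 _) (normr_ge0 _) (hl1 M) a11.
  have := ler_pM (normr_ge0 _) (normr_ge0 _) (hl2 M) a21.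
  rewrite /c; lra.
have inball n' : exists2 y, dotp y y <= r ^+ 2 & l = word_map f (mkseq w n') y.
  have [y ly] := word_map_onto (mkseq w n') l; exists y => //.
  have := word_map_dist (mkseq w n') y; rewrite /= ly size_mkseq.
  set D := _ - _ => DE.
  rewrite -(ler_pM2l (exprn_gt0 2 (lam0 n'))) -DE.
  have [->|D0] := eqVneq (dotp D D) 0; first by rewrite mulr_ge0 ?sqr_ge0.
  have Dp : 0 < dotp D D by rewrite lt_neqAle eq_sym D0 dotp_ge0.
  pose s := Num.sqrt (dotp D D).
  have s0 : 0 < s by rewrite sqrtr_gt0.
  have ss : s * s = dotp D D by rewrite -expr2 sqr_sqrtr// ltW.
  (* [close] in the direction of [D] itself bounds the norm of [D]. *)
  have := close n' (D.1 / s, D.2 / s).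
  rewrite -/D (_ : dotp D (D.1 / s, D.2 / s) = s); last first.
    apply: (mulIf (lt0r_neq0 s0)); rewrite ss /dotp /= mulrDl !mulrA !divfK ?gt_eqF//.
  rewrite (gtr0_norm s0) => /(_ _) H.
  rewrite -ss -expr2 -exprMn ler_pXn2r ?nnegrE ?(ltW s0)//; last by rewrite mulr_ge0 ?ltW.
  apply: H; rewrite /in_disk (_ : dotp _ _ = dotp D D / (s * s)); last first.
    by rewrite /dotp /=; field; rewrite gt_eqF.
  by rewrite ss divff.
have : exists x, (\bigcap_(n in [set n | (1 <= n)%N]) (word_map f (mkseq w n) @` B)) x.
  exists l => i _; have [y y1 ->] := inball i; exists y => //.
  by apply/eclosed_ballE.
move=> /(xgetPex (0, 0)); rewrite -/(coding f B w) => cap.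
case: n => [|n]; last first.
  by have [y /eclosed_ballE yB <-] := cap n.+1 isT; exists y.
have [y /eclosed_ballE yB <-] := cap 1%N isT.
by exists (word_map f (mkseq w 1) y) => //; exact: fB.
Qed.

Lemma coding_close w n a : in_disk a ->
  `|dotp (coding f B w) a - dotp (point (mkseq w n)) a| <= lambda ^+ n * r.
Proof.
move=> a1; have [y yr ->] := coding_word_map w n.
rewrite (dotp_word_map _ _ _ (mkseq w n) y) addrAC subrr add0r size_mkseq.
rewrite normrM (gtr0_norm (lam0 n)) ler_pM2l//.
apply: dotp_bound => //; first exact: ltW.
by rewrite -/(in_disk _) in_disk_rotation.
Qed.

Lemma coding_cylinder_close w w' n a : in_disk a -> cylinder (mkseq w n) w' ->
  `|dotp (coding f B w') a - dotp (coding f B w) a| <= 2 * (lambda ^+ n * r).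
Proof.
move=> a1; rewrite /cylinder /= size_mkseq => e.
have := coding_close w n a1; have := coding_close w' n a1; rewrite e.
rewrite !ler_norml => /andP[? ?] /andP[? ?]; apply/andP; split; lra.
Qed.

(** The coded point depends continuously on the word, by
    [coding_cylinder_close]. *)
Lemma measurable_halfspace a b : in_disk a ->
  measurable [set w : word_space k | dotp (coding f B w) a < b].
Proof.
move=> a1; apply: measurable_cylinder_open => w /= wb.
have [n hn] : exists n, lambda ^+ n < (b - dotp (coding f B w) a) / (2 * r).
  by apply: exprn_small; rewrite divr_gt0 ?mulr_gt0// subr_gt0.
exists n => w' /(coding_cylinder_close a1) /=.
move: hn; rewrite ltr_pdivlMr ?mulr_gt0// ler_norml => ? /andP[? ?].
by lra.
Qed.

Lemma measurable_slab a (d : R) (j : int) : 0 < d -> in_disk a ->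
  measurable [set w : word_space k | Num.floor (dotp (coding f B w) a / d) = j].
Proof.
move=> d0 a1.
rewrite (_ : [set _ | _] = [set w | dotp (coding f B w) a < (j + 1)%:~R * d] `\`
    [set w | dotp (coding f B w) a < j%:~R * d]).
  by apply: measurableD; exact: measurable_halfspace.
apply/seteqP; split=> w /=.
  move=> <-; have /andP[h1 h2] := floor_itv (dotp (coding f B w) a / d).
  rewrite -ltr_pdivrMr//; split => //; apply/negP; rewrite -leNgt.
  by rewrite -ler_pdivlMr.
move=> [h1 /negP]; rewrite -leNgt => h2.
apply: floor_def; rewrite ler_pdivlMr// h2/=.
by rewrite ltr_pdivrMr.
Qed.

End Coding.

(** * Dyadic cells and grid sums *)

Section Bridge.
Variables (R : realType) (k : nat) (lambda alpha : R) (t : 'I_k.+1 -> R * R).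
Variables (r q : R) (P : probability (word_space k) R).

Let f j := similarity lambda alpha (t j).
Let B := eclosed_ball r.
Let p := cylinder_mass P.
Let point u := word_map f u (0, 0).

Hypothesis lam01 : 0 < lambda < 1.
Hypothesis r0 : 0 < r.
Hypothesis q1 : 1 < q.
Hypothesis fB : forall j x, dotp x x <= r ^+ 2 -> dotp (f j x) (f j x) <= r ^+ 2.

Let lam0 n : 0 < lambda ^+ n. Proof. by rewrite exprn_gt0//; case/andP: lam01. Qed.
Let q1' : 1 <= q. Proof. exact: ltW. Qed.
Let q0 : 0 < q. Proof. exact: lt_trans ltr01 q1. Qed.

Let code (w : word_space k) := coding f B w.

(** The coded points of one dyadic cell, whose side is at most
    [lambda^-1 * lambda ^+ n], are displaced by at most [lambda ^+ n * r] when
    they are replaced by the points of their prefixes of length [n]; these differ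
    by at most [spread] cells of side [lambda ^+ n]. The same number serves for
    the way back. *)
Let spread := (Num.truncn (lambda^-1 + 2 * r)).+1.

Let spreadP : lambda^-1 + 2 * r <= spread%:R.
Proof.
have [l0 l1] := andP lam01.
by have /truncn_itv/andP[_ /ltW//] : 0 <= lambda^-1 + 2 * r by rewrite addr_ge0 ?invr_ge0 ?mulr_ge0// ltW.
Qed.

Definition bridge_const : R := (spread.*2.+1 * spread.*2.+1)%:R `^ (q - 1).

Lemma bridge_const_gt0 : 0 < bridge_const.
Proof. by rewrite powR_gt0// ltr0n muln_gt0. Qed.

(** The keys [J] are pairs of integers for the plane and integers for a line; the
    latter are encoded as pairs by [enc]. *)
Section Cells.
Variables (J : choiceType) (enc : J -> int * int) (G : word_space k -> J).
Variables (h : (R * R) * (R * R)) (d : R) (n : nat).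
Hypothesis enc_inj : injective enc.
Hypothesis h1 : in_disk h.1.
Hypothesis h2 : in_disk h.2.
Hypothesis d1 : lambda ^+ n <= d.
Hypothesis d2 : d * lambda <= lambda ^+ n.
Hypothesis encG : forall w, enc (G w) = grid_key d (coords h (code w)).

Let d0 : 0 < d. Proof. exact: lt_le_trans d1. Qed.

Lemma measurable_cell j : measurable [set w | G w = j].
Proof.
rewrite (_ : [set w | G w = j] =
    [set w | Num.floor (dotp (code w) h.1 / d) = (enc j).1] `&`
    [set w | Num.floor (dotp (code w) h.2 / d) = (enc j).2]).
  by apply: measurableI; apply: measurable_slab.
apply/seteqP; split=> w /=; first by move=> <-; rewrite encG.
by move=> [e1 e2]; apply: enc_inj; rewrite encG /grid_key /= e1 e2; case: (enc j).
Qed.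

Let range := [set j | exists w, G w = j].

Let code_ball w : dotp (code w) (code w) <= r ^+ 2.
Proof.
have [y yr e] := coding_word_map lam01 r0 fB w 0.
by have -> : code w = y by exact: e.
Qed.

(** The coded points lie in a ball. *)
Lemma finite_range : finite_set range.
Proof.
pose A := (Num.truncn (r / d)).+1.
have rA : r <= A%:R * d.
  have /truncn_itv/andP[_ /ltW] : 0 <= r / d by rewrite divr_ge0 ?ltW.
  by rewrite ler_pdivrMr.
apply: (@sub_finite_set _ _ (enc @^-1` [set` box A])).
  move=> _ [w <-] /=; rewrite encG.
  have := @grid_key_close R d (coords h (code w)) (0, 0) A A d0.
  rewrite [grid_key d (0, 0)]/grid_key /= mul0r floor0 !subr0 => key_le.
  have bound a : in_disk a -> `|dotp (code w) a| <= A%:R * d.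
    by move=> a1; apply: le_trans rA; exact: dotp_bound (ltW r0) _ _.
  have [b1 b2] := key_le (bound _ h1) (bound _ h2).
  exact: (@mem_box A (grid_key d (coords h (code w)))).
apply: finite_preimage; last exact: finite_seq.
by move=> x y _ _; exact: enc_inj.
Qed.

Let cells : seq J := finmap.enum_fset (fset_set range).

Let mem_cells w : G w \in cells.
Proof. have := in_fset_set finite_range (G w); rewrite /cells => ->.
by rewrite inE; exists w. Qed.

Definition cell_energy : \bar R := (\esum_(j in [set: J]) (P [set w | G w = j] `^ q))%E.

Lemma cell_energyE : fine cell_energy = \sum_(j <- cells) fine (P [set w | G w = j]) `^ q.
Proof.
rewrite /cell_energy (_ : (\esum_(j in [set: J]) _)%E =
    (\esum_(j in range) (P [set w | G w = j] `^ q))%E); last first.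
  rewrite [RHS]esum_mkcond; apply: eq_esum => j _.
  case: ifPn => // /negP jr.
  rewrite (_ : [set w | G w = j] = set0) ?measure0.
    by rewrite poweR_EFin powR0// gt_eqF.
  by apply/seteqP; split=> // w /= Gw; apply: jr; rewrite inE; exists w.
rewrite esum_fset; [|exact: finite_range|by move=> i _; exact: poweR_ge0].
rewrite fsbig_finite/=; last exact: finite_range.
rewrite (eq_bigr (fun j => (fine (P [set w | G w = j]) `^ q)%:E)); last first.
  move=> j _; rewrite -poweR_EFin fineK// fin_num_measure//; exact: measurable_cell.
by rewrite sumEFin.
Qed.

(** The masses of the intersections of the two partitions of the word space that
    are compared, into dyadic cells and into cells of the words of length [n]. *)
Let m (j : J) (i : int * int) : R :=
  \sum_(u <- words k n | grid_key (lambda ^+ n) (coords h (point u)) == i)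
    fine (P (cylinder u `&` [set w | G w = j])).

Let keys := undup (map (fun u => grid_key (lambda ^+ n) (coords h (point u))) (words k n)).

Let m_ge0 j i : 0 <= m j i.
Proof. by apply: sumr_ge0 => u _; exact: fine_measure_ge0. Qed.

Let m_word j i : m j i != 0 -> exists w, G w = j /\
  grid_key (lambda ^+ n) (coords h (point (mkseq w n))) = i.
Proof.
move=> mN0; apply: contrapT => nw; move/eqP: mN0; apply.
rewrite /m big1_seq// => u /andP[/eqP ui uw].
rewrite (_ : _ `&` _ = set0) ?measure0//.
apply/seteqP; split=> // w [wu Gw]; apply: nw; exists w; split => //.
by move: wu; rewrite /cylinder /= (size_words uw) => ->.
Qed.

Let sum_keys j : \sum_(i <- keys) m j i = fine (P [set w | G w = j]).
Proof.
rewrite (sum_by_key (fun u _ => fine (P (cylinder u `&` [set w | G w = j])))) ?undup_uniq//; last first.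
  by move=> i; rewrite mem_undup.
rewrite [RHS](@fine_measure_by_key _ _ _ _ (words k n) (fun w => mkseq w n)).
- rewrite big_seq [RHS]big_seq; apply: eq_bigr => u uw.
  by rewrite setIC /cylinder (size_words uw).
- exact: words_uniq.
- exact: measurable_cell.
- move=> u; have [un|nun] := eqVneq (size u) n.
    by rewrite -un; exact: measurable_cylinder.
  rewrite (_ : [set _ | _] = set0); first exact: measurable0.
  by apply/seteqP; split=> // w /= e; move: nun; rewrite -e size_mkseq eqxx.
- by move=> w _; apply: mem_words; rewrite size_mkseq.
Qed.

Let sum_cells i : \sum_(j <- cells) m j i =
  cell_mass (words k n) p (fun u => grid_key (lambda ^+ n) (coords h (point u))) i.
Proof.
rewrite /m exchange_big/=; apply: eq_bigr => u _.
rewrite /p /cylinder_mass [RHS](@fine_measure_by_key _ _ _ _ cells G)//.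
- exact: finmap.fset_uniq.
- exact: measurable_cylinder.
- exact: measurable_cell.
Qed.

Let near_point w a : in_disk a ->
  `|dotp (code w) a - dotp (point (mkseq w n)) a| <= lambda ^+ n * r.
Proof. exact: coding_close. Qed.

Lemma cell_energy_le : fine cell_energy <=
  bridge_const * power_sum (words k n) p
    (fun u => grid_key (lambda ^+ n) (coords h (point u))) q.
Proof.
have [l0 l1] := andP lam01.
rewrite cell_energyE; under eq_bigr do rewrite -sum_keys.
rewrite /power_sum -/keys; under [in leRHS]eq_bigr do rewrite -sum_cells.
apply: compare_partitions => // j _; apply: count_close; first exact: undup_uniq.
have close w w' a : in_disk a -> `|dotp (code w) a - dotp (code w') a| <= d ->
    `|dotp (point (mkseq w n)) a - dotp (point (mkseq w' n)) a| <= spread%:R * lambda ^+ n.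
  move=> a1; have := near_point w a1; have := near_point w' a1.
  have := ler_wpM2r (ltW (lam0 n)) spreadP.
  have : d <= lambda^-1 * lambda ^+ n by rewrite mulrC ler_pdivlMr.
  rewrite !ler_norml => ? ? /andP[? ?] /andP[? ?] /andP[? ?]; apply/andP; split; lra.
move=> i i' /m_word[w [Gw <-]] /m_word[w' [Gw' <-]].
have : grid_key d (coords h (code w)) = grid_key d (coords h (code w')).
  by rewrite -!encG Gw Gw'.
by move=> /(grid_key_eq d0)[c1 c2]; apply: grid_key_close => //; exact: close.
Qed.

Lemma power_sum_le_cell_energy :
  power_sum (words k n) p (fun u => grid_key (lambda ^+ n) (coords h (point u))) q <=
  bridge_const * fine cell_energy.
Proof.
have [l0 l1] := andP lam01.
rewrite cell_energyE; under [in leRHS]eq_bigr do rewrite -sum_keys.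
rewrite /power_sum -/keys; under [in leLHS]eq_bigr do rewrite -sum_cells.
apply: (@compare_partitions _ _ _ keys cells (fun i j => m j i)) => // i _.
pose Q e := has (fun j => (enc j == e) && (m j i != 0)%R) cells.
apply: (@leq_trans (count Q (map enc cells))).
  rewrite count_map -!size_filter; apply: uniq_leq_size.
    by rewrite filter_uniq// finmap.fset_uniq.
  move=> j; rewrite !mem_filter => /andP[mj jc]; rewrite jc andbT /=.
  by apply/hasP; exists j => //; rewrite eqxx.
apply: count_close; first by rewrite map_inj_uniq// finmap.fset_uniq.
have close w w' a : in_disk a ->
    `|dotp (point (mkseq w n)) a - dotp (point (mkseq w' n)) a| <= lambda ^+ n ->
    `|dotp (code w) a - dotp (code w') a| <= spread%:R * d.
  move=> a1; have := near_point w a1; have := near_point w' a1.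
  have := ler_wpM2r (ltW d0) spreadP.
  have : d <= lambda^-1 * d.
    by rewrite -[leLHS]mul1r ler_wpM2r ?(ltW d0)// invf_ge1// ltW.
  have : lambda ^+ n * r <= d * r by rewrite ler_pM2r.
  have dn : lambda ^+ n <= d := d1.
  rewrite !ler_norml => ? ? ? /andP[? ?] /andP[? ?] /andP[? ?]; apply/andP; split; lra.
move=> e e' /hasP[j _ /andP[/eqP <- /m_word[w [Gw iw]]]].
move=> /hasP[j' _ /andP[/eqP <- /m_word[w' [Gw' iw']]]].
have [c1 c2] := grid_key_eq (lam0 n) (etrans iw (esym iw')).
rewrite -Gw -Gw' !encG.
exact: (@grid_key_close _ _ (coords h (code w)) (coords h (code w')) _ _ d0 (close _ _ _ h1 c1) (close _ _ _ h2 c2)).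
Qed.

Lemma ln_cell_energy : 0 < grid_sum lambda alpha t q p n h ->
  `|ln (fine cell_energy) - ln (grid_sum lambda alpha t q p n h)| <= `|ln bridge_const|.
Proof.
move=> g0; have b0 := bridge_const_gt0.
have le1 : fine cell_energy <= bridge_const * grid_sum lambda alpha t q p n h := cell_energy_le.
have le2 : grid_sum lambda alpha t q p n h <= bridge_const * fine cell_energy :=
  power_sum_le_cell_energy.
have e0 : 0 < fine cell_energy by move: (lt_le_trans g0 le2); rewrite pmulr_rgt0.
move: le1 le2; move: (grid_sum _ _ _ _ _ _ _) (fine _) g0 e0 => x y x0 y0.
rewrite -ler_ln ?posrE ?mulr_gt0// -[_ <= bridge_const * y]ler_ln ?posrE ?mulr_gt0//.
rewrite !lnM ?posrE//; have := ler_norm (ln bridge_const); have := normr_ge0 (ln bridge_const).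
by move=> ? ? ? ?; rewrite ler_norml; apply/andP; split; lra.
Qed.

End Cells.
End Bridge.

(** * The dimensions of the measure and of its projections *)

Section Dyadic.
Variable R : realType.

Lemma dyadic1P n (j : int) (x : R) : dyadic1 n j x <-> Num.floor (x / 2 ^- n) = j.
Proof.
have d0 : 0 < 2 ^- n :> R by rewrite invr_gt0 exprn_gt0.
rewrite /dyadic1 /= in_itv /= ![2 ^- n * _]mulrC; split.
  move=> /andP[h1 h2]; apply: floor_def.
  by rewrite ler_pdivlMr// h1 ltr_pdivrMr// intrD.
move=> <-; have /andP[h1 h2] := floor_itv (x / 2 ^- n).
by rewrite -ler_pdivlMr// h1 -ltr_pdivrMr//; move: h2; rewrite intrD.
Qed.

(** The least [n] with [lambda ^+ n <= 2 ^- N]. *)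
Lemma dyadic_scale (lambda : R) (N : nat) : 0 < lambda < 1 -> exists n : nat,
  lambda ^+ n <= 2 ^- N /\ 2 ^- N * lambda <= lambda ^+ n.
Proof.
move=> /[dup] lam01 /andP[l0 l1]; have d0 : 0 < 2 ^- N :> R by rewrite invr_gt0 exprn_gt0.
have exn : exists n, lambda ^+ n <= 2 ^- N.
  by have [n /ltW nN] := exprn_small lam01 d0; exists n.
have [n hn minn] := ex_minnP exn; exists n; split => //.
case: n hn minn => [_ _|n hn minn].
  have : 2 ^- N <= 1 :> R by rewrite invf_le1 ?exprn_gt0// exprn_ege1// ler1n.
  by rewrite expr0; nra.
have : 2 ^- N < lambda ^+ n.
  by rewrite ltNge; apply/negP => /minn; rewrite ltnn.
by rewrite exprSr => h; rewrite ler_pM2r// ltW.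
Qed.

Lemma circleP (v : R * R) : circle v <-> dotp v v = 1.
Proof.
rewrite /circle /enorm /=; split=> [h|->]; last by rewrite sqrtr1.
by rewrite -[LHS]sqr_sqrtr ?dotp_ge0// h expr1n.
Qed.

Lemma uniform_cvg (U : choiceType) (A : set U) (F : nat -> U -> R) (g : U -> R) :
  (forall e, 0 < e -> exists N0 : nat, forall N, (N0 <= N)%N -> forall v, A v ->
    `|g v - F N v| < e) ->
  {uniform A, F @ \oo --> g}.
Proof.
move=> H Q /uniform_nbhs[E []]; rewrite -entourage_ballE => -[e /= e0 eE] EQ.
have [N0 hN] := H e e0.
by exists N0 => // N /= N0N; apply: EQ => v Av; apply: eE; exact: hN.
Qed.

End Dyadic.

Theorem corollary6p1 (R : realType) (k : nat) (lambda alpha : R)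
  (t : 'I_k.+1 -> R * R) (r K : R)
  (etabar : probability (word_space k) R) :
  let f (j : 'I_k.+1) := similarity lambda alpha (t j) in
  let B := eclosed_ball r in
  let eta : set (R * R) -> \bar R := pushforward etabar (coding f B) in
  let eta_proj (v : R * R) : set R -> \bar R := pushforward eta (proj_dir v) in
  0 < lambda < 1 ->
  0 <= alpha < 2 * pi ->
  0 < r ->
  (forall j, f j @` B `<=` B) ->
  1 < K ->
  (forall u v : seq 'I_k.+1,
    (etabar (cylinder (u ++ v)) <=
     K%:E * etabar (cylinder u) * etabar (cylinder v))%E) ->
  irrational (alpha / pi) ->
  forall q : R, 1 < q <= 2 ->
  [/\ cvgn (Lq_ratio (@dyadic2 R) eta q),
      forall v, circle v ->
        cvgn (Lq_ratio (@dyadic1 R) (eta_proj v) q) /\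
        Lq_dim (@dyadic1 R) (eta_proj v) q =
          Num.min (Lq_dim (@dyadic2 R) eta q) 1
    & {uniform @circle R,
        (fun (n : nat) (v : R * R) => Lq_ratio (@dyadic1 R) (eta_proj v) q n)
          @ \oo -->
        (fun _ : R * R => Num.min (Lq_dim (@dyadic2 R) eta q) 1)}].
Proof.
move=> f B eta eta_proj lam01 _ r0 fB K1 etaK irr q q12.
have /andP[l0 l1] := lam01; have /andP[q1 q2] := q12.
have fB' j x : dotp x x <= r ^+ 2 -> dotp (f j x) (f j x) <= r ^+ 2.
  by move=> /(eclosed_ballE r0) xB; apply/(eclosed_ballE r0)/(fB j); exists x.
pose p := cylinder_mass etabar.
have p0 u : 0 <= p u := fine_measure_ge0 etabar _.
have pnil : p [::] = 1 := cylinder_mass_nil etabar.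
have p_rcons := cylinder_mass_rcons etabar.
have p_cat := cylinder_mass_cat (ltW (lt_trans ltr01 K1)) etaK.
pose T := grid_sum lambda alpha t q p.
have [L [c [hL1 hL2]]] := grid_sum_std_limit lam01 r0 K1 q12 fB' p0 pnil p_rcons p_cat.
have upper := grid_sum_line_upper lam01 r0 K1 q12 fB' p0 pnil p_rcons p_cat irr hL2.
have [c' lower] := grid_sum_line_lower_log lam01 r0 q12 fB' p0 pnil p_rcons hL1.
have stdT n : 0 < T n (std_frame R) := grid_sum_std_gt0 lam01 r0 q12 fB' p0 pnil p_rcons n.
have lineT n v : in_disk v -> 0 < T n (line_frame v) :=
  @grid_sum_line_gt0 _ _ _ _ _ _ _ _ lam01 r0 q12 fB' p0 pnil p_rcons n v.
have [n hn] := choice (fun N => dyadic_scale N lam01).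
pose rho := - ln lambda; have rho0 : 0 < rho by rewrite oppr_gt0 ln_lt0.
have ln20 : 0 < ln 2 :> R by rewrite ln_gt0// ltr1n.
have Q0 : 0 < q - 1 by rewrite subr_gt0.
have hn' N : N%:R * ln 2 <= (n N)%:R * rho <= N%:R * ln 2 + rho.
  have [h1 h2] := hn N.
  have pw (a : R) (m : nat) : 0 < a -> 0 < a ^+ m by move=> a0; rewrite exprn_gt0.
  move: h1; rewrite -ler_ln ?posrE ?invr_gt0 ?pw// lnV ?posrE ?pw// !lnXn//.
  move: h2; rewrite -ler_ln ?posrE ?mulr_gt0 ?invr_gt0 ?pw// lnM ?posrE ?invr_gt0 ?pw//.
  rewrite lnV ?posrE ?pw// !lnXn// -![ln _ *+ _]mulr_natl /rho => ? ?.
  by apply/andP; split; lra.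
pose b := `|ln (bridge_const lambda r q)|.
have disk0 : in_disk ((0, 0) : R * R) by rewrite /in_disk /dotp /= mulr0 addr0.
have disk1 : in_disk ((1, 0) : R * R) by rewrite /in_disk /dotp /= mulr0 mulr1 addr0.
have disk2 : in_disk ((0, 1) : R * R) by rewrite /in_disk /dotp /= mulr0 mulr1 add0r.
pose s2 N := ln (fine (Lq_sum (@dyadic2 R) eta q N)).
pose s1 N v := ln (fine (Lq_sum (@dyadic1 R) (eta_proj v) q N)).
(* The dyadic sums and the grid sums agree up to a factor that depends neither
   on the scale nor on the direction. *)
have bridge2 N : `|s2 N - ln (T (n N) (std_frame R))| <= b.
  have [h1 h2] := hn N.
  have := @ln_cell_energy _ _ _ _ _ _ _ etabar lam01 r0 q1 fB' _ id
    (fun w => grid_key (2 ^- N) (coords (std_frame R) (coding f B w)))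
    (std_frame R) (2 ^- N) (n N) (@inj_id _) disk1 disk2 h1 h2 (fun=> erefl) (stdT (n N)).
  congr (`|ln (fine _) - _| <= _); apply: eq_esum => j _; congr (etabar _ `^ _)%E.
  apply/seteqP; split=> w; rewrite /= coords_std_frame.
    by move=> <-; split; exact/dyadic1P.
  by move=> [/dyadic1P j1 /dyadic1P j2]; rewrite /grid_key j1 j2; case: (j).
have bridge1 N v : circle v -> `|s1 N v - ln (T (n N) (line_frame v))| <= b.
  move=> /circleP v1; have vd : in_disk v by rewrite /in_disk v1.
  have [h1 h2] := hn N.
  have encG w : ((fun i : int => (i, 0%Z)) (Num.floor (dotp (coding f B w) v / 2 ^- N))) =
      grid_key (2 ^- N) (coords (line_frame v) (coding f B w)).
    have z (x : R * R) : dotp x (0, 0) = 0 by rewrite /dotp /= !mulr0 addr0.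
    by rewrite /grid_key /coords /= z mul0r floor0.
  have enc_inj : injective (fun i : int => (i, 0%Z)) by move=> i j [].
  have := @ln_cell_energy _ _ _ _ _ _ _ etabar lam01 r0 q1 fB' _ _ _
    (line_frame v) (2 ^- N) (n N) enc_inj vd disk0 h1 h2 encG (lineT (n N) v vd).
  congr (`|ln (fine _) - _| <= _); apply: eq_esum => j _; congr (etabar _ `^ _)%E.
  by apply/seteqP; split=> w /=; [move=> <-; exact/dyadic1P|move=> /dyadic1P].
have conv2 e : 0 < e -> exists N0 : nat, forall N, (N0 <= N)%N ->
    `|L / (- rho * (q - 1)) - Lq_ratio (@dyadic2 R) eta q N| < e.
  move=> e0; have [N0 hN0] := @rate_transfer R unit (fun=> True)
    (fun m _ => ln (T m (std_frame R))) (fun N _ => s2 N) n L b rho (ln 2) (q - 1)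
    rho0 ln20 Q0 (normr_ge0 _) hn' (fun N _ _ => bridge2 N)
    (rate_of_bounds (fun m _ _ => hL1 m) (fun e e0 =>
       let: ex_intro n0 h := hL2 e e0 in ex_intro _ n0 (fun m hm _ _ => h m hm))) e e0.
  by exists N0 => N hN; exact: hN0 N hN tt I.
pose M := Num.max L ((q - 1) * ln lambda).
have conv1 e : 0 < e -> exists N0 : nat, forall N, (N0 <= N)%N -> forall v, circle v ->
    `|M / (- rho * (q - 1)) - Lq_ratio (@dyadic1 R) (eta_proj v) q N| < e.
  apply: (@rate_transfer R _ (@circle R) (fun m v => ln (T m (line_frame v))) s1 n M b
    rho (ln 2) (q - 1) rho0 ln20 Q0 (normr_ge0 _) hn' bridge1).
  apply: (@rate_of_bounds _ _ _ _ _ c') => [m v /circleP v1|e' e'0].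
    by apply: lower; rewrite /in_disk v1.
  have [n0 hn0] := upper e' e'0.
  by exists n0 => m hm v /circleP v1; exact: hn0.
have cvg2 : Lq_ratio (@dyadic2 R) eta q @ \oo --> L / (- rho * (q - 1)).
  apply/cvgrPdist_lt => e e0; have [N0 hN] := conv2 e e0.
  by exists N0.
have dim2 : Lq_dim (@dyadic2 R) eta q = L / (- rho * (q - 1)) by exact: cvg_lim.
have minE : Num.min (Lq_dim (@dyadic2 R) eta q) 1 = M / (- rho * (q - 1)).
  have a0 : - rho * (q - 1) < 0 by rewrite nmulr_rlt0// oppr_lt0.
  rewrite dim2 /M (_ : (q - 1) * ln lambda = - rho * (q - 1)); last by rewrite opprK mulrC.
  have [La|aL] := leP L (- rho * (q - 1)).
    by rewrite divff ?lt_eqF//; apply/min_idPr; rewrite ler_ndivlMr// mul1r.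
  by apply/min_idPl; rewrite ler_ndivrMr// mul1r ltW.
split.
- by apply/cvg_ex; exists (L / (- rho * (q - 1))).
- move=> v cv.
  have cvg1 : Lq_ratio (@dyadic1 R) (eta_proj v) q @ \oo --> M / (- rho * (q - 1)).
    apply/cvgrPdist_lt => e e0; have [N0 hN] := conv1 e e0.
    by exists N0 => // N /= N0N; exact: hN.
  by split; [apply/cvg_ex; exists (M / (- rho * (q - 1)))|rewrite minE; exact: cvg_lim].
- by rewrite minE; apply: uniform_cvg.
Qed.
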